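(* Let $f:\mathbb{R}^n\times\mathbb{R}^m\to\mathbb{R}^n$ be continuous and homogeneous in the bi-limit with associated triples $((r_0,\mathfrak{r}_0),\mathfrak{d}_0,f_0)$ and $((r_\infty,\mathfrak{r}_\infty),\mathfrak{d}_\infty,f_\infty)$, where $r_0,r_\infty\in(\mathbb{R}_+\setminus\{0\})^n$ are the weights associated to $x$ and $\mathfrak{r}_0,\mathfrak{r}_\infty\in(\mathbb{R}_+\setminus\{0\})^m$ are the weights associated to $\delta$. Suppose that the origin is a globally asymptotically stable equilibrium of each of the systems $$\dot x=f(x,0),\qquad \dot x=f_0(x,0),\qquad \dot x=f_\infty(x,0).$$ Let $p\ge1$ be an integer. Then there exists a real number $c_G>0$ such that, for each class $\mathcal{K}$ function $\gamma_z$ and each class $\mathcal{KL}$ function $\beta_\delta$, there exists a class $\mathcal{KL}$ function $\beta_x$ such that the following holds. For each function $t\in[0,T)\mapsto(x(t),\delta(t),z(t))\in\mathbb{R}^n\times\mathbb{R}^m\times\mathbb{R}^p$, $T\le+\infty$, with $x$ of class $C^1$ and $\delta$ and $z$ continuous, which satisfies $\dot x(t)=f(x(t),\delta(t))$ on $[0,T)$ and, for all $0\le s\le t<T$ and all $i\in\{1,\dots,m\}$, $$|z(t)|\le\max\left\{\beta_\delta\big(|z(s)|,t-s\big),\ \sup_{s\le\kappa\le t}\gamma_z(|x(\kappa)|)\right\},$$ $$|\delta_i(t)|\le\max\left\{\beta_\delta\big(|z(s)|,t-s\big),\ c_G\sup_{s\le\kappa\le t}\mathfrak{H}\!\left(|x(\kappa)|_{r_0}^{\mathfrak{r}_{0,i}},|x(\kappa)|_{r_\infty}^{\mathfrak{r}_{\infty,i}}\right)\right\},$$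 we have $$|x(t)|\le\beta_x\big(|(x(s),z(s))|,t-s\big)\qquad\text{for all }0\le s\le t<T.$$
   Context: $\mathbb{R}_+=[0,+\infty)$. The function $\mathfrak{H}:\mathbb{R}_+^2\to\mathbb{R}_+$ is $\mathfrak{H}(a,b)=\frac{a}{1+a}\,[1+b]$. For $r\in(\mathbb{R}_+\setminus\{0\})^N$, $\lambda\in\mathbb{R}_+$, $x\in\mathbb{R}^N$: $\lambda^r\diamond x=(\lambda^{r_1}x_1,\dots,\lambda^{r_N}x_N)$ and $|x|_r=|x_1|^{1/r_1}+\dots+|x_N|^{1/r_N}$. $|\cdot|$ is the Euclidean norm. A function $\phi:\mathbb{R}^N\to\mathbb{R}$ is homogeneous in the $0$-limit with associated triple $(r_0,d_0,\phi_0)$ (weight $r_0\in(\mathbb{R}_+\setminus\{0\})^N$, degree $d_0\in\mathbb{R}_+$, approximating function $\phi_0:\mathbb{R}^N\to\mathbb{R}$) if $\phi$ is continuous, $\phi_0$ is continuous and not identically zero, and for each compact set $C\subset\mathbb{R}^N\setminus\{0\}$ and each $\varepsilon>0$ there exists $\lambda_0>0$ such that $\max_{x\in C}\left|\frac{\phi(\lambda^{r_0}\diamond x)}{\lambda^{d_0}}-\phi_0(x)\right|\le\varepsilon$ for all $\lambda\in(0,\lambda_0]$. It is homogeneous in the $\infty$-limit with associated triple $(r_\infty,d_\infty,\phi_\infty)$ if the same holds with $(r_\infty,d_\infty,\phi_\infty)$ in place of $(r_0,d_0,\phi_0)$ and ''there exists $\lambda_\infty>0$ such that ... for all $\lambda\ge\lambda_\infty$''.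 It is homogeneous in the bi-limit if it is homogeneous in both limits; its associated triples are the two corresponding triples. For $f=(f_1,\dots,f_n):\mathbb{R}^n\times\mathbb{R}^m\to\mathbb{R}^n$, being homogeneous in the bi-limit with associated triples $((r_0,\mathfrak{r}_0),\mathfrak{d}_0,f_0)$ and $((r_\infty,\mathfrak{r}_\infty),\mathfrak{d}_\infty,f_\infty)$ (with $\mathfrak{d}_0,\mathfrak{d}_\infty\in\mathbb{R}$) means that for each $i\in\{1,\dots,n\}$, $\mathfrak{d}_0+r_{0,i}\ge0$, $\mathfrak{d}_\infty+r_{\infty,i}\ge0$, and the function $f_i$ on $\mathbb{R}^{n+m}$ is homogeneous in the bi-limit with associated triples $((r_0,\mathfrak{r}_0),\mathfrak{d}_0+r_{0,i},f_{0,i})$ and $((r_\infty,\mathfrak{r}_\infty),\mathfrak{d}_\infty+r_{\infty,i},f_{\infty,i})$. *)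

(* Defs.v *)
From HB Require Import structures.
From mathcomp Require Import all_boot all_order all_algebra.
From mathcomp Require Import all_classical all_reals all_analysis.
Set Implicit Arguments.
Unset Strict Implicit.
Unset Printing Implicit Defensive.
Import Order.TTheory GRing.Theory Num.Theory.
Import numFieldNormedType.Exports.
Local Open Scope classical_set_scope.
Local Open Scope ring_scope.

(* The library norm `|x| on 'rV[R]_n is the sup norm. *)
Definition enorm (R : realType) (n : nat) (x : 'rV[R]_n) : R :=
  Num.sqrt (\sum_(i < n) x 0 i ^+ 2).

Definition hfun (R : realType) (a b : R) : R := a / (1 + a) * (1 + b).

Definition dilation (R : realType) (N : nat) (lambda : R) (r x : 'rV[R]_N)
  : 'rV[R]_N := \row_(i < N) (lambda `^ r 0 i * x 0 i).

Definition hnorm (R : realType) (N : nat) (r x : 'rV[R]_N) : R :=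
  \sum_(i < N) `|x 0 i| `^ (r 0 i)^-1.

Definition is_weight (R : realType) (N : nat) (r : 'rV[R]_N) : Prop :=
  forall i, 0 < r 0 i.

Definition homogeneous_0limit (R : realType) (N : nat)
    (phi : 'rV[R]_N -> R) (r : 'rV[R]_N) (d : R) (phi0 : 'rV[R]_N -> R)
    : Prop :=
  [/\ is_weight r, 0 <= d, continuous phi,
      continuous phi0 /\ (exists x, phi0 x != 0) &
      forall C : set 'rV[R]_N, compact C -> ~ C 0 ->
      forall eps : R, 0 < eps ->
      exists2 lambda0 : R, 0 < lambda0 &
        forall lambda : R, 0 < lambda -> lambda <= lambda0 ->
        forall x, C x ->
        `|phi (dilation lambda r x) / lambda `^ d - phi0 x| <= eps].

Definition homogeneous_ylimit (R : realType) (N : nat)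
    (phi : 'rV[R]_N -> R) (r : 'rV[R]_N) (d : R) (phiy : 'rV[R]_N -> R)
    : Prop :=
  [/\ is_weight r, 0 <= d, continuous phi,
      continuous phiy /\ (exists x, phiy x != 0) &
      forall C : set 'rV[R]_N, compact C -> ~ C 0 ->
      forall eps : R, 0 < eps ->
      exists2 lambday : R, 0 < lambday &
        forall lambda : R, lambday <= lambda ->
        forall x, C x ->
        `|phi (dilation lambda r x) / lambda `^ d - phiy x| <= eps].

(* The i-th component of f, as a real function on R^(n+m). *)
Definition component (R : realType) (n m : nat)
    (f : 'rV[R]_n * 'rV[R]_m -> 'rV[R]_n) (i : 'I_n) (w : 'rV[R]_(n + m)) : R :=
  f (lsubmx w, rsubmx w) 0 i.

(* The sign conditions d0 + r0_i >= 0 and dy + ry_i >= 0 on the degrees are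
   part of homogeneous_0limit and homogeneous_ylimit. *)
Definition vf_homogeneous_bilimit (R : realType) (n m : nat)
    (f : 'rV[R]_n * 'rV[R]_m -> 'rV[R]_n)
    (r0 : 'rV[R]_n) (s0 : 'rV[R]_m) (d0 : R)
    (f0 : 'rV[R]_n * 'rV[R]_m -> 'rV[R]_n)
    (ry : 'rV[R]_n) (sy : 'rV[R]_m) (dy : R)
    (fy : 'rV[R]_n * 'rV[R]_m -> 'rV[R]_n) : Prop :=
  forall i : 'I_n,
    homogeneous_0limit (component f i) (row_mx r0 s0) (d0 + r0 0 i)
      (component f0 i) /\
    homogeneous_ylimit (component f i) (row_mx ry sy) (dy + ry 0 i)
      (component fy i).

(* Functions on R_+ are total functions on R whose values at negative
   arguments are irrelevant. *)
Definition class_K (R : realType) (g : R -> R) : Prop :=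
  [/\ {within [set a | 0 <= a], continuous g}, g 0 = 0 &
      forall a b : R, 0 <= a -> a < b -> g a < g b].

(* As usual for class KL, "decreasing" in the second argument is
   non-strict (strictness is impossible at a = 0). *)
Definition class_KL (R : realType) (b : R -> R -> R) : Prop :=
  [/\ {within [set q : R * R | 0 <= q.1 /\ 0 <= q.2],
        continuous (fun q : R * R => b q.1 q.2)},
      forall t : R, 0 <= t -> class_K (fun a => b a t),
      forall a t1 t2 : R, 0 <= a -> 0 <= t1 -> t1 <= t2 -> b a t2 <= b a t1 &
      forall a : R, 0 <= a -> b a t @[t --> +oo] --> (0 : R)].

(* The half-open interval [0, T), with T possibly infinite. *)
Definition time_itv (R : realType) (T : \bar R) : set R :=
  [set t | 0 <= t /\ (t%:E < T)%E].

(* The derivative is relative to D: on [0, T) it is one-sided at t = 0. *)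
Definition derivative_on (R : realType) (n : nat) (D : set R)
    (x dx : R -> 'rV[R]_n) : Prop :=
  forall t, D t ->
    ((s - t)^-1 *: (x s - x t)) @[s --> within D t^'] --> dx t.

Definition ode_solution (R : realType) (n : nat) (g : 'rV[R]_n -> 'rV[R]_n)
    (T : \bar R) (x : R -> 'rV[R]_n) : Prop :=
  (0 < T)%E /\ derivative_on (time_itv T) x (fun t => g (x t)).

Definition maximal_solution (R : realType) (n : nat)
    (g : 'rV[R]_n -> 'rV[R]_n) (T : \bar R) (x : R -> 'rV[R]_n) : Prop :=
  ode_solution g T x /\
  forall (T' : \bar R) (y : R -> 'rV[R]_n), (T < T')%E ->
    ode_solution g T' y -> ~ (forall t, time_itv T t -> y t = x t).

(* g is only continuous, so solutions need not be unique nor a priori global: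
   stability and attractivity are required of all solutions from a given
   initial condition, and maximal solutions must be defined on [0, +oo). *)
Definition globally_asymptotically_stable (R : realType) (n : nat)
    (g : 'rV[R]_n -> 'rV[R]_n) : Prop :=
  [/\ g 0 = 0,
      forall eps : R, 0 < eps ->
        exists2 eta : R, 0 < eta &
          forall (T : \bar R) (x : R -> 'rV[R]_n), ode_solution g T x ->
            enorm (x 0) < eta ->
            forall t, time_itv T t -> enorm (x t) < eps &
      forall (T : \bar R) (x : R -> 'rV[R]_n), maximal_solution g T x ->
        T = +oo%E /\ (enorm (x t) @[t --> +oo] --> (0 : R))].

(* Main.v *)
(** The theorem is proved without Lyapunov functions.  Measure the size of [x] by a
    scale [l]: |x_i| <= l^(r0_i) for [l <= 1] and |x_i| <= l^(ry_i) for [l >= 1].  After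
    rescaling by [l] in space and by [l^d] in time, [f] is uniformly close on bounded sets to [f0]
    as [l -> 0] and to [fy] as [l -> +oo], while scales in between range over a compact
    set where [f] itself is used.  An asymptotically stable field is robust to small
    perturbations: a sequence of counterexamples with perturbations tending to zero would
    converge, along an ultrafilter, to a solution of the unperturbed system that stays away
    from the origin or blows up.  Hence there is a constant [c] such that, at every scale [l], inputs
    below [c] times that scale keep [x] below [L] times the scale and eventually bring it
    to the scale [l/2].  The bound on [delta] closes the loop by a first exit argument, and
    iterating the halving gives the uniform attraction from which the KL bound is built. *)

Require Import Defs.
From HB Require Import structures.
From mathcomp Require Import all_boot all_order all_algebra.
From mathcomp Require Import all_classical all_reals all_analysis.
From mathcomp Require Import ring lra.
Set Implicit Arguments.
Unset Strict Implicit.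
Unset Printing Implicit Defensive.
Import Order.TTheory GRing.Theory Num.Theory.
Import numFieldNormedType.Exports.
Local Open Scope classical_set_scope.
Local Open Scope ring_scope.

(** The fields are only continuous, so there is neither uniqueness nor a Gronwall estimate to
    compare perturbed and unperturbed trajectories, and counterexamples need not live on a common
    time interval. Their limit is therefore studied up to the supremum [T] of the times until which
    almost all of them stay uniformly bounded. An infinite [T] contradicts attractivity. If [T] is
    finite, the limit cannot blow up at [T], because every maximal solution of an asymptotically
    stable field is global; the counterexamples must then themselves end around time [T], close to a
    value of the limit.

    The halving time depends on the scale and need not be bounded over all scales. This is harmless:
    passing from a given radius to a given precision takes finitely many halvings. No gain condition
    links [x] and [z], since [z] acts on [delta] only through [beta_d], which fades, and remains
    bounded once [x] is. Hence the gain on [delta] can be fixed before [gamma_z] and [beta_d]. *)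

(** * Norms, compactness and ultrafilters in finite dimension *)

Lemma rv_norm_le (R : realType) n (x : 'rV[R]_n) (B : R) :
  0 <= B -> (forall i, `|x 0 i| <= B) -> `|x| <= B.
Proof.
move=> B0 xB; rewrite [leLHS]/Num.Def.normr /= mx_normrE.
by apply/bigmax_leP; split=> // -[i j] _ /=; rewrite ord1.
Qed.

Lemma rv_coord_le (R : realType) n (x : 'rV[R]_n) i : `|x 0 i| <= `|x|.
Proof.
rewrite [leRHS]/Num.Def.normr /= mx_normrE.
by apply/bigmax_geP; right => /=; exists (0, i).
Qed.

Lemma norm_le_enorm (R : realType) n (x : 'rV[R]_n) : `|x| <= enorm x.
Proof.
apply: rv_norm_le => [|i]; first exact: sqrtr_ge0.
rewrite -sqrtr_sqr ler_sqrt ?sqr_ge0// ?sumr_ge0// => [|j _]; last exact: sqr_ge0.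
by rewrite (bigD1 i)//= lerDl sumr_ge0// => j _; exact: sqr_ge0.
Qed.

Lemma closed_ball0_compact (R : realType) n (B : R) :
  compact [set x : 'rV[R]_n | `|x| <= B].
Proof.
apply: bounded_closed_compact.
  by exists B; split=> [|M BM x /= xB]; [exact: num_real|rewrite (le_trans xB)// ltW].
apply: (@closed_comp _ _ (fun x : 'rV[R]_n => `|x|) [set r | r <= B]).
  by move=> x _; exact: norm_continuous.
exact: closed_le.
Qed.

Lemma continuous_bounded_ball (R : realType) n (V : normedModType R)
    (g : 'rV[R]_n -> V) (B : R) :
  continuous g -> exists2 C : R, 0 < C & forall x, `|x| <= B -> `|g x| <= C.
Proof.
move=> gc; have /compact_bounded[C [_ gC]] :
    compact (g @` [set x : 'rV[R]_n | `|x| <= B]).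
  apply: continuous_compact; last exact: closed_ball0_compact.
  exact: continuous_subspaceT.
exists (Num.max 1 (C + 1)); first by rewrite lt_max ltr01.
by move=> x xB; apply: gC; [rewrite lt_max ltrDl ltr01 orbT|exists x].
Qed.

(** The tube lemma: near each point of the compact ball the estimate holds for [d] close to [0], and
    compactness makes this closeness uniform. *)
Lemma continuous_uniform_perturbation (R : realType) n m (V : normedModType R)
    (F : 'rV[R]_n * 'rV[R]_m -> V) (B e : R) :
  continuous F -> 0 < e ->
  exists2 c : R, 0 < c &
    forall x d, `|x| <= B -> `|d| <= c -> `|F (x, d) - F (x, 0)| <= e.
Proof.
move=> Fc e0.
have /compact_near_coveringP := @closed_ball0_compact R n B.
move=> /(_ _ (nbhs (0 : 'rV[R]_m)) (fun d x => `|F (x, d) - F (x, 0)| <= e) _).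
move=> H; have /nbhs_ballP[c /= c0 cP] : \forall d \near (0 : 'rV[R]_m),
    [set x : 'rV[R]_n | `|x| <= B] `<=` (fun x => `|F (x, d) - F (x, 0)| <= e).
  apply: H => x _.
  have h : (fun q : 'rV[R]_n * 'rV[R]_m => F q - F (q.1, 0)) @
      ((x, 0) : 'rV[R]_n * 'rV[R]_m) --> F (x, 0) - F (x, 0).
    apply: cvgB; first exact: Fc.
    apply: (@cvg_comp _ _ _ (fun q : 'rV[R]_n * 'rV[R]_m => (q.1, 0 : 'rV[R]_m))
      F _ (nbhs ((x, 0) : 'rV[R]_n * 'rV[R]_m))); last exact: Fc.
    apply: (@cvg_pair _ _ _ _ (nbhs x) (nbhs (0 : 'rV[R]_m)));[exact: cvg_fst|exact: cvg_cst].
  rewrite subrr in h; move/cvgr0Pnorm_le : h => /(_ _ e0).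
  by move=> h2; apply: filterS h2 => -[? ?].
exists (c / 2); first by rewrite divr_gt0.
move=> x d xB dc; apply: cP => //.
rewrite -ball_normE /= sub0r normrN (le_lt_trans dc)// ltr_pdivrMr//; lra.
Qed.

(** Compactness in its ultrafilter form gives a limit of the whole sequence, without extracting a
    subsequence. *)
Lemma ultra_bounded_limit (R : realType) n (U : set_system nat)
    (u : nat -> 'rV[R]_n) (B : R) :
  UltraFilter U -> U [set k | `|u k| <= B] ->
  exists2 l, `|l| <= B & forall e : R, 0 < e -> U [set k | `|u k - l| <= e].
Proof.
move=> UU uB; have := @closed_ball0_compact R n B.
rewrite compact_ultra => /(_ (u @ U) _).
have UuU : UltraFilter (u @ U).
  split=> [|G GF sG]; first exact: fmap_proper_filter.
  rewrite predeqE => A; split; last exact: sG.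
  move=> GA; have [//|nA] := in_ultra_setVsetC (u @^-1` A) UU.
  have GnA : G (~` A) by apply: sG.
  by have /filter_ex[? []] : G (A `&` ~` A) by exact: filterI.
move=> /(_ UuU uB)[l [lB cl]]; exists l => // e e0.
by move/cvgrPdist_le : cl => /(_ _ e0); apply: filterS => k; rewrite distrC.
Qed.

Lemma ultra_infty : exists2 U : set_system nat, UltraFilter U &
  forall k0 : nat, U [set k | (k0 <= k)%N].
Proof.
have [U [UU sU]] := ultraFilterLemma (@eventually_filter : ProperFilter \oo).
by exists U => // k0; apply: sU; exists k0.
Qed.

Lemma ultra_setI T (U : set_system T) (A B : set T) :
  UltraFilter U -> U A -> U B -> U (A `&` B).
Proof. by move=> UU; exact: filterI. Qed.

Lemma ultra_ex T (U : set_system T) (A : set T) :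
  UltraFilter U -> U A -> exists k, A k.
Proof. by move=> UU; exact: filter_ex. Qed.

(** * Trajectories *)

(* The mean value inequality is all that survives pointwise limits and rescaling, so it replaces differentiability. *)
Definition trajectory (R : realType) n (t : R) (y dy : R -> 'rV[R]_n) : Prop :=
  (forall i a b v K, 0 <= a -> a <= b -> b <= t ->
     (forall s, a <= s <= b -> `|dy s 0 i - v| <= K) ->
     `|y b 0 i - y a 0 i - (b - a) * v| <= K * (b - a)) /\
  exists C, forall s, 0 <= s <= t -> `|dy s| <= C.

Lemma trajectory_mean_value (R : realType) n (t : R) (y dy : R -> 'rV[R]_n)
    a b v K :
  trajectory t y dy -> 0 <= a -> a <= b -> b <= t ->
  (forall s, a <= s <= b -> `|dy s - v| <= K) ->
  `|y b - y a - (b - a) *: v| <= K * (b - a).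
Proof.
move=> [yt _] a0 ab bt dyK; apply: rv_norm_le => [|i].
  by rewrite mulr_ge0 ?subr_ge0// (le_trans (normr_ge0 _) (dyK a _))// lexx.
rewrite !mxE; apply: yt => // s /dyK; apply: le_trans.
by have := rv_coord_le (dy s - v) i; rewrite !mxE.
Qed.

Lemma trajectory_lipschitz (R : realType) n (t : R) (y dy : R -> 'rV[R]_n)
    a b K :
  trajectory t y dy -> 0 <= a -> a <= b -> b <= t ->
  (forall s, a <= s <= b -> `|dy s| <= K) -> `|y b - y a| <= K * (b - a).
Proof.
move=> yt a0 ab bt dyK; have := @trajectory_mean_value _ _ _ _ _ a b 0 K yt a0 ab bt.
by rewrite scaler0 subr0; apply=> s; rewrite subr0; exact: dyK.
Qed.

Lemma trajectory_sub (R : realType) n (t t' : R) (y dy : R -> 'rV[R]_n) :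
  t' <= t -> trajectory t y dy -> trajectory t' y dy.
Proof.
move=> tt [yt [C dyC]]; split; last first.
  by exists C => s /andP[s0 st]; apply: dyC; rewrite s0 (le_trans st).
by move=> i a b v K a0 ab bt; apply: yt => //; exact: le_trans tt.
Qed.

Lemma trajectory_shift (R : realType) n (t s : R) (y dy : R -> 'rV[R]_n) :
  0 <= s -> trajectory t y dy ->
  trajectory (t - s) (fun r => y (s + r)) (fun r => dy (s + r)).
Proof.
move=> s0 [yt [C dyC]]; split; last first.
  by exists C => r /andP[r0 rt]; apply: dyC; apply/andP; split; lra.
move=> i a b v K a0 ab bt dyK.
rewrite (_ : b - a = (s + b) - (s + a)); last by ring.
apply: yt; [lra|lra|lra|move=> r /andP[r0 r1]].
by have := dyK (r - s); rewrite subrKC; apply; apply/andP; split; lra.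
Qed.

(** The time found is the supremum of those up to which [phi] never exceeds [l]; it may come after a
    first touch of the level. The Lipschitz bound serves as continuity. *)
Lemma first_hit (R : realType) (phi : R -> R) (C t l : R) :
  (forall a b, 0 <= a -> a <= b -> b <= t -> `|phi b - phi a| <= C * (b - a)) ->
  0 <= t -> phi 0 <= l -> l <= phi t ->
  exists t', [/\ 0 <= t', t' <= t, phi t' = l &
    forall s, 0 <= s <= t' -> phi s <= l].
Proof.
move=> phiC t0 phi0 phit.
(* [C] is not known to be positive, and the constant is going to be divided by. *)
pose D := `|C| + 1; have D0 : 0 < D by rewrite ltr_pwDr.
have phiD a b : 0 <= a -> a <= b -> b <= t -> `|phi b - phi a| <= D * (b - a).
  move=> a0 ab bt; apply: le_trans (phiC _ _ a0 ab bt) _.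
  rewrite ler_wpM2r ?subr_ge0// /D; have := ler_norm C; lra.
have near a b : 0 <= a -> a <= b -> b <= t -> forall e, b - a <= e / D ->
    `|phi b - phi a| <= e.
  move=> a0 ab bt e abe; apply: le_trans (phiD _ _ a0 ab bt) _.
  by rewrite mulrC -ler_pdivlMr.
pose S := [set s | 0 <= s <= t /\ forall r, 0 <= r <= s -> phi r <= l].
have S0 : S 0.
  by split=> [|r]; rewrite ?lexx// -eq_le => /eqP <-.
have Sub : has_sup S by split; [exists 0|exists t => s -[/andP[]]].
have T0 : 0 <= sup S by apply: sup_upper_bound.
have Tt : sup S <= t by apply: ge_sup; [exists 0|move=> s [/andP[]]].
have below r : 0 <= r -> r < sup S -> phi r <= l.
  move=> r0 rS; have rS0 : 0 < sup S - r by rewrite subr_gt0.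
  by have [s [_ sS] rs] := sup_adherent rS0 Sub; apply: sS; apply/andP; split; lra.
have le : phi (sup S) <= l.
  rewrite leNgt; apply/negP => lt; move: T0; rewrite le_eqVlt => /orP[/eqP T0|T0].
    by move: lt; rewrite -T0 ltNge phi0.
  have e0 : 0 < (phi (sup S) - l) / 2 / D by rewrite !divr_gt0// subr_gt0.
  (* Stepping back by [d] lowers [phi] by at most half of its excess over [l], which contradicts
     [below]. *)
  pose d := Num.min (sup S) ((phi (sup S) - l) / 2 / D).
  have d0 : 0 < d by rewrite lt_min T0.
  have dS : d <= sup S by rewrite ge_min lexx.
  have de : d <= (phi (sup S) - l) / 2 / D by rewrite ge_min lexx orbT.
  have h1 := below (sup S - d); have h2 := near (sup S - d) (sup S).
  have h3 : phi (sup S - d) <= l by apply: h1; lra.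
  have : `|phi (sup S) - phi (sup S - d)| <= (phi (sup S) - l) / 2 by apply: h2; lra.
  by rewrite ler_norml => /andP[]; lra.
have allle s : 0 <= s <= sup S -> phi s <= l.
  by move=> /andP[s0]; rewrite le_eqVlt => /orP[/eqP -> //|]; exact: below.
exists (sup S); split=> //; apply/eqP; rewrite eq_le le/= leNgt; apply/negP => lt.
have Tlt : sup S < t.
  by rewrite lt_neqAle Tt andbT; apply/eqP => E; move: lt; rewrite E ltNge phit.
have e0 : 0 < (l - phi (sup S)) / D by rewrite divr_gt0// subr_gt0.
(* Going forward by [d] cannot bring [phi] above [l], so [sup S + d] would still belong to [S]. *)
pose d := Num.min (t - sup S) ((l - phi (sup S)) / D).
have d0 : 0 < d by rewrite lt_min subr_gt0 Tlt.
have dS : d <= t - sup S by rewrite ge_min lexx.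
have de : d <= (l - phi (sup S)) / D by rewrite ge_min lexx orbT.
suff /(sup_upper_bound Sub) : S (sup S + d) by lra.
split; first by apply/andP; split; lra.
move=> r /andP[r0 rd]; have [rS|Sr] := leP r (sup S); first by apply: allle; rewrite r0.
have : `|phi r - phi (sup S)| <= l - phi (sup S) by apply: near; lra.
by rewrite ler_norml => /andP[]; lra.
Qed.

(** Time reversal and a change of sign reduce this to [first_hit]. *)
Lemma last_hit (R : realType) (phi : R -> R) (C t l : R) :
  (forall a b, 0 <= a -> a <= b -> b <= t -> `|phi b - phi a| <= C * (b - a)) ->
  0 <= t -> phi 0 <= l -> l <= phi t ->
  exists t', [/\ 0 <= t', t' <= t, phi t' = l &
    forall s, t' <= s <= t -> l <= phi s].
Proof.
move=> phiC t0 phi0 phit.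
have [| | | |t' [t'0 t't E H]] := @first_hit _ (fun s => - phi (t - s)) C t (- l).
- move=> a b a0 ab bt; rewrite opprK addrC.
  rewrite (_ : b - a = (t - a) - (t - b)); last by ring.
  by apply: phiC; lra.
- by [].
- by rewrite subr0 lerN2.
- by rewrite subrr lerN2.
exists (t - t'); split; [lra|lra|lra|move=> s /andP[s1 s2]].
by have := H (t - s); rewrite subKr lerN2; apply; apply/andP; split; lra.
Qed.

(** Multiplying the difference quotient by [|s - t|] removes the division, so that [s = t] is
    allowed. *)
Lemma derivative_onP (R : realType) n (D : set R) (x dx : R -> 'rV[R]_n) :
  derivative_on D x dx <->
  forall t, D t -> forall e : R, 0 < e -> exists2 h : R, 0 < h &
    forall s, D s -> `|s - t| <= h ->
    `|x s - x t - (s - t) *: dx t| <= e * `|s - t|.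
Proof.
split=> [H t Dt e e0|H t Dt].
  have := H t Dt; move=> /cvgrPdist_le /(_ _ e0).
  rewrite !near_withinE => /nbhs_ballP[h /= h0 hP].
  exists (h / 2); first by rewrite divr_gt0.
  move=> s Ds sh; have [->|st] := eqVneq s t.
    by rewrite !subrr scale0r subrr !normr0 mulr0.
  have st0 : s - t != 0 by rewrite subr_eq0.
  have ball_s : ball t h s by rewrite -ball_normE /= distrC (le_lt_trans sh)//; lra.
  have := hP _ ball_s st Ds.
  rewrite -(ler_pM2r (_ : 0 < `|s - t|)) ?normr_gt0//; apply: le_trans.
  rewrite mulrC -normrZ scalerBr scalerA divff// scale1r distrC.
  by rewrite addrC opprB lexx.
apply/cvgrPdist_le => e e0; rewrite !near_withinE.
have [h h0 hP] := H t Dt e e0; apply/nbhs_ballP; exists h => //= s sh st Ds.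
have st0 : s - t != 0 by rewrite subr_eq0.
rewrite -(ler_pM2r (_ : 0 < `|s - t|)) ?normr_gt0//.
rewrite mulrC -normrZ scalerBr scalerA divff// scale1r distrC.
by apply: hP => //; move: sh; rewrite -ball_normE /= distrC => /ltW.
Qed.

Lemma trajectory_norm_lipschitz (R : realType) n (t : R) (y dy : R -> 'rV[R]_n) :
  trajectory t y dy -> exists C, forall a b, 0 <= a -> a <= b -> b <= t ->
    `| `|y b| - `|y a| | <= C * (b - a).
Proof.
move=> yt; have [_ [C dyC]] := yt; exists C => a b a0 ab bt.
apply: le_trans (ler_dist_dist _ _) _.
apply: (trajectory_lipschitz yt) => // s /andP[s1 s2]; apply: dyC.
by rewrite (le_trans a0)//= (le_trans s2).
Qed.

(** From the ball of radius [B], a trajectory must travel at least 2 to leave the ball of radius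
    [B + 2], but while it is inside, its speed allows at most 1. The constant is found before the
    trajectory, so it serves a whole sequence of them. *)
Lemma local_speed (R : realType) n (g : 'rV[R]_n -> 'rV[R]_n) (B : R) :
  continuous g -> exists2 C : R, 0 < C & forall t y dy, trajectory t y dy ->
    (forall s, 0 <= s <= t -> `|dy s - g (y s)| <= 1) ->
    forall a b, 0 <= a -> a <= b -> b <= t -> `|y a| <= B -> C * (b - a) <= 1 ->
    `|y b - y a| <= C * (b - a).
Proof.
move=> gc; have [C C0 gC] := continuous_bounded_ball (B + 2) gc.
exists (C + 1); first by rewrite addr_gt0.
move=> t y dy yt dyg.
have speed a b : 0 <= a -> a <= b -> b <= t ->
    (forall s, a <= s <= b -> `|y s| <= B + 2) -> `|y b - y a| <= (C + 1) * (b - a).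
  move=> a0 ab bt yB; apply: (trajectory_lipschitz yt) => // s sab.
  have := dyg s; case/andP: (sab) => sa sb.
  rewrite (le_trans a0 sa) (le_trans sb bt) => /(_ isT) h.
  rewrite -(subrK (g (y s)) (dy s)) (le_trans (ler_normD _ _))// addrC lerD//.
  by apply: gC; apply: yB.
move=> a b a0 ab bt yaB Cab.
have [|/existsNP[s /not_implyP[/andP[sa sb] /negP]]] :=
  pselect (forall s, a <= s <= b -> `|y s| <= B + 2); first exact: speed.
rewrite -ltNge => ys.
have [K yK] := trajectory_norm_lipschitz yt.
have [| | | |r [r0 rs E rB]] :=
    @first_hit _ (fun r => `|y (a + r)|) K (s - a) (B + 2).
- move=> c d c0 cd ds; rewrite (_ : d - c = (a + d) - (a + c)); last by ring.
  by apply: yK; lra.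
- by rewrite subr_ge0.
- by rewrite addr0; lra.
- by rewrite subrKC ltW.
have : `|y (a + r) - y a| <= (C + 1) * ((a + r) - a).
  apply: speed; [lra|lra|lra|move=> q /andP[q1 q2]].
  by have := rB (q - a); rewrite subrKC; apply; apply/andP; split; lra.
have h : (C + 1) * ((a + r) - a) <= (C + 1) * (b - a) by rewrite ler_pM2l; lra.
have := ler_normB (y (a + r) - y a) (- y a).
by rewrite normrN opprK subrK E; lra.
Qed.

(** * Ultralimits of trajectories *)

(** These times are closed downwards in the nonnegative reals; their supremum plays the role of the
    lifetime of the limit. *)
Definition ultra_bounded (R : realType) n (U : set_system nat)
    (t_ : nat -> R) (y_ : nat -> R -> 'rV[R]_n) (t : R) : Prop :=
  0 <= t /\ exists B, U [set k | t <= t_ k /\ forall s, 0 <= s <= t -> `|y_ k s| <= B].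

Lemma ultra_bounded_sub (R : realType) n (U : set_system nat)
    (t_ : nat -> R) (y_ : nat -> R -> 'rV[R]_n) (s t : R) :
  UltraFilter U -> 0 <= s -> s <= t ->
  ultra_bounded U t_ y_ t -> ultra_bounded U t_ y_ s.
Proof.
move=> UU s0 st [t0 [B UB]]; split=> //; exists B; apply: filterS UB => k [tk yB].
split; first exact: le_trans tk.
by move=> r /andP[r0 rs]; apply: yB; rewrite r0 (le_trans rs).
Qed.

(** One ultrafilter serves uncountably many times at once, which replaces the diagonal extraction of
    the Arzela-Ascoli theorem. *)
Lemma ultra_pointwise_limit (R : realType) n (U : set_system nat)
    (t_ : nat -> R) (y_ : nat -> R -> 'rV[R]_n) :
  UltraFilter U -> exists y : R -> 'rV[R]_n, forall t, ultra_bounded U t_ y_ t ->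
    forall e : R, 0 < e -> U [set k | `|y_ k t - y t| <= e].
Proof.
move=> UU; suff /choice[y yP] : forall t, exists l, ultra_bounded U t_ y_ t ->
  forall e : R, 0 < e -> U [set k | `|y_ k t - l| <= e] by exists y.
move=> t; have [[t0 [B UB]]|nE] := pselect (ultra_bounded U t_ y_ t); last by exists 0.
have [|l _ lP] := @ultra_bounded_limit _ _ U (fun k => y_ k t) B UU.
  by apply: filterS UB => k [_ yB]; apply: yB; rewrite t0 lexx.
by exists l.
Qed.

Lemma ultra_inv_small (R : realType) (U : set_system nat) (e : R) :
  UltraFilter U -> (forall k0 : nat, U [set k | (k0 <= k)%N]) -> 0 < e ->
  U [set k | k.+1%:R^-1 <= e].
Proof.
move=> UU Uoo e0; apply: filterS (Uoo (Num.truncn e^-1).+1) => k /= ek.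
rewrite -[e]invrK lef_pV2 ?posrE ?invr_gt0//.
rewrite (le_trans (ltW (truncnS_gt _)))// ler_nat; exact: leqW.
Qed.

(** Near [t], almost all the [dy_ k] stay within [e] of [g (y t)]: the speed bound keeps [y_ k]
    close to [y t] on a time window whose width does not depend on [k]. The mean value inequality
    for [y_ k] then passes to the pointwise limit. *)
Lemma ultra_limit_derivative (R : realType) n (g : 'rV[R]_n -> 'rV[R]_n)
    (U : set_system nat) (t_ : nat -> R) (y_ dy_ : nat -> R -> 'rV[R]_n)
    (y : R -> 'rV[R]_n) (t t' : R) :
  continuous g -> UltraFilter U -> (forall k0 : nat, U [set k | (k0 <= k)%N]) ->
  (forall k, trajectory (t_ k) (y_ k) (dy_ k)) ->
  (forall k s, 0 <= s <= t_ k -> `|dy_ k s - g (y_ k s)| <= k.+1%:R^-1) ->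
  (forall t, ultra_bounded U t_ y_ t -> forall e : R, 0 < e ->
     U [set k | `|y_ k t - y t| <= e]) ->
  0 <= t -> t <= t' -> ultra_bounded U t_ y_ t' -> forall e : R, 0 < e ->
  exists2 h, 0 < h & forall s, 0 <= s <= t' -> `|s - t| <= h ->
    `|y s - y t - (s - t) *: g (y t)| <= e * `|s - t|.
Proof.
move=> gc UU Uoo ty dyg yP t0 tt' Et' e e0.
have [t'0 [B UB]] := Et'.
have ylim s : 0 <= s <= t' -> forall e : R, 0 < e -> U [set k | `|y_ k s - y s| <= e].
  by move=> /andP[s0 st]; apply: yP; exact: ultra_bounded_sub Et'.
have e20 : 0 < e / 2 by rewrite divr_gt0.
have := gc (y t); move=> /cvgrPdist_le /(_ _ e20) /nbhs_ballP[h0 /= h00 hg].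
have [C C0 CP] := local_speed B gc.
(* Within time [h] the speed bound applies, as [C * h <= 1], and [y_ k] moves by at most [h0 / 4];
   adding the gap at time [t], it stays within [h0] of [y t]. *)
pose h := Num.min C^-1 (h0 / 4 / C).
have hh0 : 0 < h by rewrite lt_min invr_gt0 C0 !divr_gt0.
have hC1 : C * h <= 1.
  by rewrite mulrC -ler_pdivlMr// div1r ge_min lexx.
have hC2 : C * h <= h0 / 4.
  by rewrite mulrC -ler_pdivlMr// ge_min lexx orbT.
exists h => // s st' sth; apply/ler_addgt0Pr => q q0.
have q20 : 0 < q / 2 by rewrite divr_gt0.
have h40 : 0 < h0 / 4 by rewrite divr_gt0.
have t0t' : 0 <= t <= t' by rewrite t0.
(* Up to the slack [q], a single index meeting finitely many ultrafilter conditions is enough. *)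
have [k [[[tk yB] [ytq yth]] [ysq [ke k1]]]] : exists k,
    ((t' <= t_ k /\ forall s, 0 <= s <= t' -> `|y_ k s| <= B) /\
     (`|y_ k t - y t| <= q / 2 /\ `|y_ k t - y t| <= h0 / 4)) /\
    (`|y_ k s - y s| <= q / 2 /\ (k.+1%:R^-1 <= e / 2 /\ k.+1%:R^-1 <= 1 :> R)).
  apply: (@filter_ex _ U); apply: filterI; apply: filterI; first exact: UB.
  - by apply: filterI; apply: ylim.
  - exact: ylim.
  - by apply: filterI; exact: ultra_inv_small.
have dyg1 r : 0 <= r <= t_ k -> `|dy_ k r - g (y_ k r)| <= 1.
  by move=> /dyg /le_trans; apply.
have /andP[s0 st] := st'.
have speed a b : 0 <= a -> a <= b -> b <= t' -> b - a <= h ->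
    `|y_ k b - y_ k a| <= h0 / 4.
  move=> a0 ab bt abh; have Cab : C * (b - a) <= C * h by rewrite ler_pM2l.
  apply: le_trans (le_trans Cab hC2).
  apply: (CP _ _ _ (ty k)) => //; first exact: le_trans tk.
    by apply: yB; rewrite a0 (le_trans ab).
  exact: le_trans hC1.
have close r : 0 <= r <= t' -> `|r - t| <= h -> `|dy_ k r - g (y t)| <= e.
  move=> /andP[r0 rt'] rth.
  have ykrt : `|y_ k r - y_ k t| <= h0 / 4.
    move: rth; rewrite ler_norml => /andP[rh1 rh2]; have [tr|rt] := leP t r.
      exact: speed.
    by rewrite distrC; apply: speed; lra.
  have /hg : ball (y t) h0 (y_ k r).
    rewrite -ball_normE /= -(subrK (y_ k t) (y t)) -addrA.
    by rewrite (le_lt_trans (ler_normD _ _))// [`|y t - _|]distrC [`|y_ k t - y_ k r|]distrC; lra.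
  rewrite /= => gr.
  have := dyg k r; rewrite r0 (le_trans rt' tk) => /(_ isT)/le_trans/(_ ke) h1.
  rewrite -(subrK (g (y_ k r)) (dy_ k r)) -addrA (le_trans (ler_normD _ _))//.
  by rewrite distrC in gr; lra.
have main : `|y_ k s - y_ k t - (s - t) *: g (y t)| <= e * `|s - t|.
  move: sth; rewrite ler_norml => /andP[sh1 sh2]; have [ts|st2] := leP t s.
    rewrite ger0_norm ?subr_ge0//.
    apply: (trajectory_mean_value (ty k)) => //; first exact: le_trans tk.
    by move=> r /andP[r1 r2]; apply: close; rewrite ?ler_norml; apply/andP; split; lra.
  rewrite ltr0_norm ?subr_lt0// opprB -normrN.
  rewrite (_ : - (y_ k s - y_ k t - (s - t) *: g (y t)) = y_ k t - y_ k s - (t - s) *: g (y t)); last first.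
    by apply/rowP => i; rewrite !mxE; ring.
  apply: (trajectory_mean_value (ty k)) => //; [lra|exact: le_trans tk|].
  by move=> r /andP[r1 r2]; apply: close; rewrite ?ler_norml; apply/andP; split; lra.
rewrite (_ : y s - y t - (s - t) *: g (y t) =
  (y_ k s - y_ k t - (s - t) *: g (y t)) + ((y_ k t - y t) - (y_ k s - y s))); last first.
  by apply/rowP => i; rewrite !mxE; ring.
rewrite (le_trans (ler_normD _ _))// lerD// (le_trans (ler_normB _ _))//; lra.
Qed.

Lemma limit_norm_bounds (R : realType) n (U : set_system nat)
    (u : nat -> 'rV[R]_n) (l : 'rV[R]_n) (a b : R) :
  UltraFilter U -> (forall e : R, 0 < e -> U [set k | `|u k - l| <= e]) ->
  (U [set k | a <= `|u k|] -> a <= `|l|) /\ (U [set k | `|u k| <= b] -> `|l| <= b).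
Proof.
move=> UU ul; split=> H; apply/ler_addgt0Pr => e e0;
  have [k [/= h1 h2]] := ultra_ex UU (ultra_setI UU (ul _ e0) H).
- have := ler_normD (u k - l) l; rewrite subrK; lra.
- have := ler_normB (u k) (u k - l); rewrite subKr; lra.
Qed.

(** An unbounded solution on [[0, T)] would be maximal, since any extension is differentiable at [T]
    and therefore bounded just before [T]; but maximal solutions have infinite lifetime. *)
Lemma gas_bounded_or_tends (R : realType) n (g : 'rV[R]_n -> 'rV[R]_n) (T : R)
    (y : R -> 'rV[R]_n) :
  globally_asymptotically_stable g -> 0 < T -> ode_solution g T%:E y ->
  (forall t, 0 <= t < T -> exists B, forall s, 0 <= s <= t -> `|y s| <= B) ->
  exists B, forall s, 0 <= s < T -> `|y s| <= B.
Proof.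
move=> [_ _ gasA] T0 soly locB; apply: contrapT => nB.
suff /gasA[] : maximal_solution g T%:E y by [].
split=> // T' z TT' [_ /derivative_onP solz] zy; apply: nB.
have TT : time_itv T' T by split; [exact: ltW|].
have [h h0 hP] := solz T TT 1 ltr01.
pose a := Num.max 0 (T - h).
have aT : a < T by rewrite gt_max T0 gtrBl.
have a0 : 0 <= a by rewrite le_max lexx.
have aTh : T - h <= a by rewrite le_max lexx orbT.
have [|B yB] := locB a; first by rewrite a0.
exists (Num.max B (`|z T| + (1 + `|g (z T)|) * h)) => s /andP[s0 sT].
rewrite le_max; have [sa|sa] := leP s a; first by rewrite yB// s0.
apply/orP; right; have st : time_itv T%:E s by split=> //; rewrite lte_fin.
have st' : time_itv T' s by split=> //; rewrite (lt_trans _ TT')// lte_fin.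
rewrite -(zy _ st).
have sTh : `|s - T| <= h by rewrite ler_norml; apply/andP; split; lra.
have := hP s st' sTh; rewrite mul1r => h1.
have h2 : `|(s - T) *: g (z T)| <= h * `|g (z T)| by rewrite normrZ ler_wpM2r.
have := ler_normD (z s - z T - (s - T) *: g (z T)) ((s - T) *: g (z T) + z T).
have := ler_normD ((s - T) *: g (z T)) (z T).
by rewrite addrA !subrK; lra.
Qed.

(** Common core of [total_stability] and [bounded_escape]; in the proof, [E] collects the times of
    uniform boundedness and [T] is its supremum. The last two hypotheses keep the [y_ k] from ending
    at once, which makes [T] positive. *)
Lemma limit_solution (R : realType) n (g : 'rV[R]_n -> 'rV[R]_n)
    (U : set_system nat) (t_ : nat -> R) (y_ dy_ : nat -> R -> 'rV[R]_n)
    (M mu L : R) :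
  continuous g -> globally_asymptotically_stable g ->
  UltraFilter U -> (forall k0 : nat, U [set k | (k0 <= k)%N]) ->
  (forall k, 0 <= t_ k) ->
  (forall k, trajectory (t_ k) (y_ k) (dy_ k)) ->
  (forall k s, 0 <= s <= t_ k -> `|dy_ k s - g (y_ k s)| <= k.+1%:R^-1) ->
  (forall k, `|y_ k 0| <= M) ->
  0 < mu -> (forall k s, 0 <= s <= t_ k -> mu <= `|y_ k s|) ->
  M < L -> (forall k, L <= `|y_ k (t_ k)| \/ k%:R <= t_ k) ->
  exists T (y : R -> 'rV[R]_n),
    [/\ 0 < T, ode_solution g T%:E y, `|y 0| <= M &
     forall e, 0 < e -> exists2 s, 0 <= s < T &
       U [set k | `|y_ k (t_ k)| <= `|y s| + e /\ t_ k <= 2 * T + 1]].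
Proof.
move=> gc gas UU Uoo t_0 ty dyg yM mu0 ymu ML yend.
have [y yP] := ultra_pointwise_limit t_ y_ UU.
pose E := ultra_bounded U t_ y_.
have Edown s t : 0 <= s -> s <= t -> E t -> E s by exact: ultra_bounded_sub.
have deriv := ultra_limit_derivative gc UU Uoo ty dyg yP.
have sol T : (0 < T)%E -> (forall t, time_itv T t -> exists2 t', t < t' & E t') ->
    ode_solution g T y.
  move=> T0 TE; split=> //; apply/derivative_onP => t Tt e e0.
  have [t0 _] := Tt; have [t' tt' Et'] := TE _ Tt.
  have [h h0 hP] := deriv t t' t0 (ltW tt') Et' e e0.
  exists (Num.min h (t' - t)); first by rewrite lt_min h0 subr_gt0.
  move=> s [s0 _]; rewrite le_min => /andP[sh st]; apply: hP => //.
  by rewrite s0/=; have := ler_norm (s - t); lra.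
have dyg1 k s : 0 <= s <= t_ k -> `|dy_ k s - g (y_ k s)| <= 1.
  by move=> /dyg /le_trans; apply; rewrite invf_le1 ?ltr0n// ler1n.
(* Moving from norm [M] to norm [L] takes a time bounded below, and the other alternative makes
   [t_ k] large with [k]. *)
have Epos : exists2 h : R, 0 < h & E h.
  have [C C0 CP] := local_speed M gc.
  pose h := Num.min C^-1 ((L - M) / 2 / C).
  have h0 : 0 < h by rewrite lt_min invr_gt0 C0 !divr_gt0// subr_gt0.
  have hC1 : C * h <= 1 by rewrite mulrC -ler_pdivlMr// div1r ge_min lexx.
  have hC2 : C * h <= (L - M) / 2.
    by rewrite mulrC -ler_pdivlMr// ge_min lexx orbT.
  have speed k s : 0 <= s -> s <= t_ k -> s <= h -> `|y_ k s| <= M + C * h.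
    move=> s0 st sh; have Csh : C * s <= C * h by rewrite ler_pM2l.
    have := CP _ _ _ (ty k) (dyg1 k) 0 s (lexx _) s0 st (yM k).
    rewrite subr0 => /(_ (le_trans Csh hC1)) h1.
    have := ler_normD (y_ k s - y_ k 0) (y_ k 0); rewrite subrK.
    have := yM k; lra.
  exists h => //; split; first exact: ltW.
  exists (M + C * h); apply: filterS (Uoo (Num.truncn h).+1) => k /= hk.
  have htk : h <= t_ k.
    rewrite leNgt; apply/negP => tkh.
    have [|] := yend k; first by have := speed k (t_ k) (t_0 k) (lexx _) (ltW tkh); lra.
    apply/negP; rewrite -ltNge (lt_trans tkh)// (lt_le_trans (truncnS_gt _))//.
    by rewrite ler_nat.
  split=> // s /andP[s0 sh]; apply: speed => //; exact: le_trans htk.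
have [h0 h00 Eh0] := Epos.
have E0 : E 0 by apply: Edown Eh0 => //; exact: ltW.
have yt_mu t : E t -> mu <= `|y t|.
  move=> Et; have [H _] := limit_norm_bounds mu 0 UU (yP t Et); apply: H.
  have [t0 [B]] := Et; apply: filterS => k [tk _].
  by apply: ymu; rewrite t0.
have y0M : `|y 0| <= M.
  have [_ H] := limit_norm_bounds 0 M UU (yP 0 E0); apply: H.
  by apply: filterS (Uoo 0%N) => k _; exact: yM.
have yB t : E t -> exists B, forall s, 0 <= s <= t -> `|y s| <= B.
  move=> Et; have [t0 [B UB]] := Et; exists B => s /andP[s0 st].
  have [_ H] := limit_norm_bounds 0 B UU (yP s (Edown _ _ s0 st Et)); apply: H.
  by apply: filterS UB => k [_]; apply; rewrite s0.
(* Otherwise the limit is a solution on [[0, +oo)] whose norm never falls below [mu], contrary to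
   attractivity. *)
have Ebnd : exists2 t0, 0 <= t0 & ~ E t0.
  apply: contrapT => nE; have allE t : 0 <= t -> E t.
    by move=> t0; apply: contrapT => nEt; apply: nE; exists t.
  have [_ _ /(_ +oo%E y)[]] := gas.
    split; last by move=> T' z; rewrite ltNge leey.
    by apply: sol => // t [t0 _]; exists (t + 1); [rewrite ltrDl|apply: allE; lra].
  move=> _ /cvgrPdist_lt /(_ _ mu0) [M0 [_ MP]].
  pose t := Num.max 0 (M0 + 1).
  have Mt : M0 < t by rewrite lt_max ltrDl ltr01 orbT.
  have t0 : 0 <= t by rewrite le_max lexx.
  have := MP _ Mt; rewrite /= sub0r normrN ger0_norm ?sqrtr_ge0//.
  apply/negP; rewrite -leNgt (le_trans (yt_mu t (allE _ t0)))//.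
  exact: norm_le_enorm.
have [t1 t10 nEt1] := Ebnd.
have Esup : has_sup E.
  split; first by exists 0.
  by exists t1 => t Et; rewrite leNgt; apply/negP => /ltW t1t; apply: nEt1; exact: Edown Et.
pose T := sup E.
have T0 : 0 < T by apply: (lt_le_trans h00); exact: sup_upper_bound.
have ET t : 0 <= t -> t < T -> exists2 t', t < t' & E t'.
  move=> t0 tT; have Tt : 0 < T - t by rewrite subr_gt0.
  by have [t' Et' h] := sup_adherent Tt Esup; exists t' => //; rewrite subKr in h.
have ET' t : 0 <= t -> t < T -> E t.
  by move=> t0 /(ET t t0)[t' /ltW tt' ]; exact: Edown.
have solT : ode_solution g T%:E y by apply: sol => // t [t0]; rewrite lte_fin; exact: ET.
have [|B yTB] := gas_bounded_or_tends gas T0 solT.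
  by move=> t /andP[t0 tT]; apply: yB; exact: ET'.
exists T, y; split=> // e e0.
have [C C0 CP] := local_speed (B + 1) gc.
(* The window from [s = T - d] to [s + 2 * d] straddles [T], and over it the speed bound allows a
   displacement of at most 1 and at most [e / 2]. *)
pose d := Num.min (Num.min 1 T) (Num.min (C^-1 / 2) (e / 4 / C)).
have d0 : 0 < d by rewrite !lt_min ltr01 T0 !divr_gt0// invr_gt0.
have : d <= d by []; rewrite {2}/d !le_min -!andbA => /and4P[d1 dT dC1 dC2].
have {}dC1 : C * (2 * d) <= 1.
  have : C * d <= C * (C^-1 / 2) by rewrite ler_pM2l.
  by rewrite mulrA divff ?gt_eqF//; lra.
have {}dC2 : C * (2 * d) <= e / 2.
  have : C * d <= C * (e / 4 / C) by rewrite ler_pM2l.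
  by rewrite [C * (_ / _)]mulrC divfK ?gt_eqF//; lra.
pose s := T - d; have s0 : 0 <= s by rewrite subr_ge0.
have sT : s < T by rewrite gtrBl.
have Es := ET' _ s0 sT.
have ysB : `|y s| <= B by apply: yTB; rewrite s0.
have q0 : 0 < Num.min 1 (e / 2) by rewrite lt_min ltr01 divr_gt0.
exists s; first by rewrite s0.
have [_ [Bs UBs]] := Es.
have speed k b : s <= t_ k -> `|y_ k s - y s| <= Num.min 1 (e / 2) ->
    s <= b -> b <= t_ k -> b <= s + 2 * d -> `|y_ k b - y_ k s| <= C * (2 * d).
  move=> stk; rewrite le_min => /andP[ys1 ys2] sb btk bd.
  have Cbd : C * (b - s) <= C * (2 * d) by rewrite ler_pM2l//; lra.
  apply: (le_trans _ Cbd); apply: (CP _ _ _ (ty k)) => //; first exact: dyg1.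
    by have := ler_normD (y_ k s - y s) (y s); rewrite subrK; lra.
  lra.
(* Otherwise almost all the [y_ k] last until [s + 2 * d = T + d] and stay bounded up to there,
   which puts a time beyond the supremum into [E]. *)
have late : U [set k | t_ k < s + 2 * d].
  have [//|H] := in_ultra_setVsetC [set k | t_ k < s + 2 * d] UU.
  have : E (s + 2 * d).
    split; first lra.
    exists (Num.max Bs (B + 2)); apply: filterS (ultra_setI UU H (ultra_setI UU UBs (yP s Es _ q0))).
    move=> k [/= /negP]; rewrite -leNgt => sdt [[stk yBs] ysq]; split=> // r /andP[r0 rd].
    rewrite le_max; have [rs|sr] := leP r s; first by rewrite yBs// r0.
    apply/orP; right; have := speed k r stk ysq (ltW sr) (le_trans rd sdt) rd.
    move: ysq; rewrite le_min => /andP[ys1 _].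
    have := ler_normD (y_ k r - y_ k s) (y_ k s); rewrite subrK.
    have := ler_normD (y_ k s - y s) (y s); rewrite subrK; lra.
  by move/(sup_upper_bound Esup); rewrite -/T /s; lra.
apply: filterS (ultra_setI UU late (ultra_setI UU UBs (yP s Es _ q0))) => k [/= tks [[stk _] ysq]].
split; last by rewrite /s in tks; lra.
have := speed k (t_ k) stk ysq stk (lexx _) (ltW tks).
move: ysq; rewrite le_min => /andP[_ ys2].
have := ler_normD (y_ k (t_ k) - y_ k s) (y_ k s); rewrite subrK.
have := ler_normD (y_ k s - y s) (y s); rewrite subrK; lra.
Qed.

(** * Robustness of asymptotic stability *)

Lemma enorm_le_norm (R : realType) n (x : 'rV[R]_n) : enorm x <= n.+1%:R * `|x|.
Proof.
rewrite -[leRHS]ger0_norm ?mulr_ge0// -sqrtr_sqr ler_sqrt ?sqr_ge0//.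
apply: (@le_trans _ _ (\sum_(i < n) `|x| ^+ 2)).
  apply: ler_sum => i _; rewrite -[leLHS]real_normK ?num_real//.
  by rewrite lerXn2r ?nnegrE//; exact: rv_coord_le.
rewrite sumr_const card_ord exprMn -[_ *+ n]mulr_natl ler_wpM2r ?sqr_ge0//.
by rewrite -natrX ler_nat (leq_trans (leqnSn n))// expnS expn1 leq_pmulr.
Qed.

(** Each counterexample is cut between its last passage at norm [eta] and its exit at norm [e]. The
    pieces keep away from the origin, so they converge to a solution that starts within [eta] and by
    stability remains below [e / 2], although it comes close to their endpoints, of norm [e]. *)
Lemma total_stability (R : realType) n (g : 'rV[R]_n -> 'rV[R]_n) (e : R) :
  continuous g -> globally_asymptotically_stable g -> 0 < e ->
  exists eta c, [/\ 0 < eta, eta < e, 0 < c &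
    forall t y dy, 0 <= t -> trajectory t y dy -> `|y 0| <= eta ->
      (forall s, 0 <= s <= t -> `|y s| <= e -> `|dy s - g (y s)| <= c) ->
      `|y t| <= e].
Proof.
move=> gc gas e0; have e20 : 0 < e / 2 by rewrite divr_gt0.
have [_ /(_ _ e20)[eta0 eta00 stab] _] := gas.
(* Stability is stated for the Euclidean norm while trajectories are measured in the sup norm: hence
   the factor [n.+1], and a factor 2 for strictness. *)
pose eta := Num.min (e / 2) (eta0 / 2 / n.+1%:R).
have eta_gt0 : 0 < eta by rewrite lt_min e20 !divr_gt0.
have eta_e : eta < e by rewrite gt_min; apply/orP; left; lra.
have etaP (x : 'rV[R]_n) : `|x| <= eta -> enorm x < eta0.
  rewrite le_min => /andP[_]; rewrite ler_pdivlMr// mulrC => h.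
  by apply: le_lt_trans (enorm_le_norm x) _; lra.
apply: contrapT => nH.
have bad (k : nat) : exists d : R * (R -> 'rV[R]_n) * (R -> 'rV[R]_n),
    [/\ 0 <= d.1.1, trajectory d.1.1 d.1.2 d.2, `|d.1.2 0| <= eta,
      forall s, 0 <= s <= d.1.1 -> eta <= `|d.1.2 s| /\
        `|d.2 s - g (d.1.2 s)| <= k.+1%:R^-1 & `|d.1.2 d.1.1| = e].
  apply: contrapT => nD; apply: nH; exists eta, k.+1%:R^-1; split=> //.
  move=> t y dy t0 ty y0 dyk; rewrite leNgt; apply/negP => yt; apply: nD.
  have [C yC] := trajectory_norm_lipschitz ty.
  have [] := first_hit yC t0 (le_trans y0 (ltW eta_e)) (ltW yt).
  move=> t1 [t10 t1t yt1 yle].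
  have ty1 := trajectory_sub t1t ty.
  have [C1 yC1] := trajectory_norm_lipschitz ty1.
  have [|t2 [t20 t21 yt2 yge]] := last_hit yC1 t10 y0; first by rewrite yt1 ltW.
  exists (t1 - t2, fun s => y (t2 + s), fun s => dy (t2 + s)); split=> /=.
  - by rewrite subr_ge0.
  - exact: trajectory_shift.
  - by rewrite addr0 yt2.
  - move=> s /andP[s0 st]; split; first by apply: yge; apply/andP; split; lra.
    apply: dyk; first by apply/andP; split; lra.
    by apply: yle; apply/andP; split; lra.
  - by rewrite subrKC.
have [d dP] := choice bad.
have [U UU Uoo] := ultra_infty.
have [k|k|k s|k||k s||k|T [y [T0 soly y0 H]]] := @limit_solution _ _ g U
    (fun k => (d k).1.1) (fun k => (d k).1.2) (fun k => (d k).2) eta eta e gc gas UU Uoo.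
- by have [] := dP k.
- by have [] := dP k.
- by have [_ _ _ h _] := dP k => /h[].
- by have [] := dP k.
- by [].
- by have [_ _ _ h _] := dP k => /h[].
- by [].
- by left; have [_ _ _ _ ->] := dP k.
have e40 : 0 < e / 4 by rewrite divr_gt0.
have [s /andP[s0 sT] /(ultra_ex UU)[k [h _]]] := H _ e40.
have [_ _ _ _ E] := dP k; rewrite E in h.
have := stab _ _ soly (etaP _ y0) s; have := norm_le_enorm (y s).
by move=> h1 /(_ (conj s0 _)); rewrite lte_fin => /(_ sT); lra.
Qed.

(** The three constants are refuted together: a counterexample to the [k]-th choice reaches norm
    [L k] or lasts until time [k], whereas [limit_solution] bounds both final norms and durations
    along the ultrafilter. *)
Lemma bounded_escape (R : realType) n (g : 'rV[R]_n -> 'rV[R]_n) (M mu : R) :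
  continuous g -> globally_asymptotically_stable g -> 0 < mu ->
  exists c L tau, [/\ 0 < c, 0 < L, 0 < tau &
    forall t y dy, 0 <= t -> trajectory t y dy -> `|y 0| <= M ->
      (forall s, 0 <= s <= t -> mu <= `|y s|) ->
      (forall s, 0 <= s <= t -> `|y s| <= L -> `|dy s - g (y s)| <= c) ->
      `|y t| <= L /\ t < tau].
Proof.
move=> gc gas mu0; apply: contrapT => nH.
pose L (k : nat) : R := `|M| + 1 + k%:R.
have ML k : M < L k by rewrite /L -addrA ltr_pwDr ?ler_norm// ltr_pwDl.
have bad (k : nat) : exists d : R * (R -> 'rV[R]_n) * (R -> 'rV[R]_n),
    [/\ 0 <= d.1.1, trajectory d.1.1 d.1.2 d.2, `|d.1.2 0| <= M,
      forall s, 0 <= s <= d.1.1 -> mu <= `|d.1.2 s| /\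
        `|d.2 s - g (d.1.2 s)| <= k.+1%:R^-1 &
      L k <= `|d.1.2 d.1.1| \/ k%:R <= d.1.1].
  apply: contrapT => nD; apply: nH; exists k.+1%:R^-1, (L k), k.+1%:R; split=> //.
    by rewrite /L -addrA ltr_wpDl// ltr_pwDl.
  move=> t y dy t0 ty y0 ymu dyk; apply: contrapT => nC; apply: nD.
  (* The perturbation is known to be small only inside the ball of radius [L k], so a trajectory
     leaving this ball is cut when it reaches the sphere. *)
  have [yL|] := pselect (forall s, 0 <= s <= t -> `|y s| <= L k).
    exists (t, y, dy); split=> //=.
      by move=> s st; split; [exact: ymu|apply: dyk => //; exact: yL].
    right; rewrite leNgt; apply/negP => tk; apply: nC; split.
      by apply: yL; rewrite t0 lexx.
    by rewrite (lt_trans tk)// ltr_nat.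
  move=> /existsNP[s /not_implyP[/andP[s0 st] /negP]]; rewrite -ltNge => ys.
  have ty1 := trajectory_sub st ty.
  have [C yC] := trajectory_norm_lipschitz ty1.
  have [] := first_hit yC s0 (le_trans y0 (ltW (ML k))) (ltW ys).
  move=> t1 [t10 t1s yt1 yle].
  exists (t1, y, dy); split=> //=; first exact: trajectory_sub ty1.
    move=> r /andP[r0 rt].
    have rt' : 0 <= r <= t by rewrite r0 (le_trans rt)// (le_trans t1s).
    by split; [exact: ymu|apply: dyk => //; apply: yle; rewrite r0].
  by left; rewrite yt1.
have [d dP] := choice bad.
have [U UU Uoo] := ultra_infty.
have [k|k|k s|k||k s||k|T [y [T0 soly y0 H]]] := @limit_solution _ _ g U
    (fun k => (d k).1.1) (fun k => (d k).1.2) (fun k => (d k).2) M mu (L 0) gc gas UU Uoo.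
- by have [] := dP k.
- by have [] := dP k.
- by have [_ _ _ h _] := dP k => /h[].
- by have [] := dP k.
- by [].
- by have [_ _ _ h _] := dP k => /h[].
- exact: ML.
- have [_ _ _ _ [h|h]] := dP k; last by right.
  by left; rewrite (le_trans _ h)// /L addr0 lerDl.
have [s _ UH] := H _ ltr01.
(* Indices beyond this [K] exceed both the bound on the final norms and the one on the durations. *)
pose K := Num.truncn (`|y s| + 1 + 2 * T + 1).
have [k [[/= h1 h2] Kk]] := ultra_ex UU (ultra_setI UU UH (Uoo K.+1)).
have h3 : `|y s| + 1 + 2 * T + 1 < k%:R.
  by rewrite (lt_le_trans (truncnS_gt _))// ler_nat.
have [_ _ _ _ [h|h]] := dP k; last first.
  by have := normr_ge0 (y s); lra.
by have := normr_ge0 M; rewrite /L in h; lra.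
Qed.

(** Either the trajectory avoids the ball of radius [eta], and [bounded_escape] bounds both its size
    and its duration, or it enters this ball at some time [s], and [total_stability] applied from
    [s] on keeps it below [e]. *)
Lemma robust_stability (R : realType) n (g : 'rV[R]_n -> 'rV[R]_n) (M e : R) :
  continuous g -> globally_asymptotically_stable g -> 0 < e ->
  exists c L tau, [/\ 0 < c, 0 < L, 0 < tau &
    forall t y dy, 0 <= t -> trajectory t y dy -> `|y 0| <= M ->
      (forall s, 0 <= s <= t -> `|y s| <= L -> `|dy s - g (y s)| <= c) ->
      `|y t| <= L /\ (tau <= t -> `|y t| <= e)].
Proof.
move=> gc gas e0; have [eta [c1 [eta0 etae c10 stab]]] := total_stability gc gas e0.
have [c2 [L [tau [c20 L0 tau0 esc]]]] := bounded_escape M gc gas eta0.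
exists (Num.min c1 c2), (Num.max L e), tau; split=> //.
- by rewrite lt_min c10.
- by rewrite lt_max L0.
move=> t y dy t0 ty y0 dyc.
have [ymu|] := pselect (forall s, 0 <= s <= t -> eta <= `|y s|).
  have [|yL ttau] := esc t y dy t0 ty y0 ymu.
    move=> s st ysL; have := dyc s st; rewrite !le_min le_max ysL => /(_ isT).
    by case/andP.
  by rewrite le_max yL [tau <= t]leNgt ttau.
move=> /existsNP[s /not_implyP[/andP[s0 st] /negP]]; rewrite -ltNge => ys.
suff yte : `|y t| <= e by rewrite le_max yte orbT.
have := stab (t - s) _ _ _ (trajectory_shift s0 ty).
rewrite subr_ge0 addr0 subrKC => /(_ st (ltW ys)); apply=> r /andP[r0 rt] yr.
have := dyc (s + r); rewrite !le_min !le_max yr orbT.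
have -> : 0 <= s + r <= t by apply/andP; split; lra.
by move=> /(_ isT isT)/andP[].
Qed.

(** * Homogeneous approximations *)

Lemma ex_small_all (R : realType) (I : finType) (P : I -> R -> Prop) :
  (forall i, exists2 h, 0 < h & forall l, 0 < l -> l <= h -> P i l) ->
  exists2 h, 0 < h & forall l, 0 < l -> l <= h -> forall i, P i l.
Proof.
move=> H; have /choice[h hP] : forall i, exists h, 0 < h /\
    forall l, 0 < l -> l <= h -> P i l.
  by move=> i; have [h h0 hP] := H i; exists h.
exists (\big[Num.min/1]_i h i).
  by apply/bigmin_gtP; split=> // i _; have [] := hP i.
move=> l l0 lh i; have [_] := hP i; apply=> //.
by move: lh => /bigmin_geP[_]; apply.
Qed.

Lemma ex_large_all (R : realType) (I : finType) (P : I -> R -> Prop) :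
  (forall i, exists h, forall l, h <= l -> P i l) ->
  exists2 h, 0 < h & forall l, h <= l -> forall i, P i l.
Proof.
move=> /choice[h hP]; exists (\big[Num.max/1]_i h i).
  by apply/bigmax_gtP; left.
by move=> l /bigmax_leP[_ hl] i; apply: hP; exact: hl.
Qed.

Lemma ler_powR_base (R : realType) (a b r : R) :
  0 <= r -> 0 <= a -> a <= b -> a `^ r <= b `^ r.
Proof.
by move=> r0 a0 ab; apply: ge0_ler_powR; rewrite ?nnegrE//; exact: le_trans ab.
Qed.

Lemma powR_root (R : realType) (a r : R) : 0 < r -> 0 <= a -> (a `^ r^-1) `^ r = a.
Proof. by move=> r0 a0; rewrite -powRrM mulVf ?gt_eqF// powRr1. Qed.

Lemma powR_rootK (R : realType) (a r : R) : 0 < r -> 0 <= a -> (a `^ r) `^ r^-1 = a.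
Proof. by move=> r0 a0; rewrite -powRrM mulfV ?gt_eqF// powRr1. Qed.

Lemma powR_le_inv (R : realType) (a b r : R) :
  0 < r -> 0 <= a -> 0 <= b -> a `^ r <= b `^ r -> a <= b.
Proof.
move=> r0 a0 b0; rewrite !leNgt; apply: contra => ba.
by apply: gt0_ltr_powR; rewrite ?nnegrE.
Qed.

Lemma powR_small (R : realType) (r e : R) : 0 < r -> 0 < e ->
  exists2 h, 0 < h & forall l, 0 < l -> l <= h -> l `^ r <= e.
Proof.
move=> r0 e0; exists (e `^ r^-1); first exact: powR_gt0.
move=> l l0 lh; rewrite -(powR_root r0 (ltW e0)).
by apply: ler_powR_base => //; exact: ltW.
Qed.

Lemma powR_large (R : realType) (r K : R) : 0 < r ->
  exists2 h, 0 < h & forall l, h <= l -> K <= l `^ r.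
Proof.
move=> r0; have K0 : 0 < Num.max 1 K by rewrite lt_max ltr01.
exists (Num.max 1 K `^ r^-1); first exact: powR_gt0.
move=> l hl; rewrite (@le_trans _ _ (Num.max 1 K)) ?le_max ?lexx ?orbT//.
rewrite -(powR_root r0 (ltW K0)).
by apply: ler_powR_base => //; [exact: ltW|exact: powR_ge0].
Qed.

Lemma continuous_delta (R : realType) (V W : normedModType R) (g : V -> W) x (e : R) :
  continuous g -> 0 < e ->
  exists2 h : R, 0 < h & forall z, `|z - x| <= h -> `|g z - g x| <= e.
Proof.
move=> gc e0; have := gc x; move=> /cvgrPdist_le /(_ _ e0) /nbhs_ballP[h /= h0 hP].
exists (h / 2); first by rewrite divr_gt0.
move=> z zx; rewrite distrC; apply: hP.
by rewrite -ball_normE /= distrC (le_lt_trans zx)//; lra.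
Qed.

Lemma dilationM (R : realType) n (l m : R) (r x : 'rV[R]_n) :
  0 <= l -> 0 <= m -> dilation (l * m) r x = dilation l r (dilation m r x).
Proof. by move=> l0 m0; apply/rowP => i; rewrite !mxE powRM// mulrA. Qed.

Lemma dilation0 (R : realType) n (l : R) (r : 'rV[R]_n) : dilation l r 0 = 0.
Proof. by apply/rowP => i; rewrite !mxE mulr0. Qed.

Lemma dilation_neq0 (R : realType) n (l : R) (r x : 'rV[R]_n) :
  0 < l -> x != 0 -> dilation l r x != 0.
Proof.
move=> l0; apply: contra => /eqP/rowP h; apply/eqP/rowP => i.
have := h i; rewrite !mxE => /eqP; rewrite mulf_eq0 gt_eqF ?powR_gt0//=.
by move/eqP.
Qed.

Lemma dilation_small (R : realType) n (r : 'rV[R]_n) (B e : R) :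
  is_weight r -> 0 < e ->
  exists2 h, 0 < h & forall l, 0 < l -> l <= h ->
    forall x : 'rV[R]_n, `|x| <= B -> `|dilation l r x| <= e.
Proof.
move=> r0 e0; have B0 : 0 < `|B| + 1 by rewrite ltr_pwDr.
have eB : 0 < e / (`|B| + 1) by rewrite divr_gt0.
have [h h0 hP] := ex_small_all (fun i => powR_small (r0 i) eB).
exists h => // l l0 lh x xB; apply: rv_norm_le => [|i]; first exact: ltW.
rewrite mxE normrM ger0_norm ?powR_ge0//.
rewrite -[leRHS](@divfK _ (`|B| + 1)) ?gt_eqF//.
apply: ler_pM => //; [exact: powR_ge0|exact: hP|].
by rewrite (le_trans (rv_coord_le _ _))// (le_trans xB)// (le_trans (ler_norm _))// lerDl.
Qed.

(** Polar coordinates adapted to the dilation: the radius [m] is the largest [F j], a homogeneous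
    sup norm of [w], and [i] is an index attaining it, which gives [u] a coordinate of modulus
    one. *)
Lemma dilation_sphere (R : realType) n (r w : 'rV[R]_n) :
  is_weight r -> w != 0 -> exists m u i,
    [/\ 0 < m, `|u| = 1, w = dilation m r u & `|w 0 i| = m `^ r 0 i].
Proof.
move=> r0 w0.
have [i0 wi0] : exists i, w 0 i != 0.
  apply: contrapT => /forallNP h; move/eqP : w0; apply; apply/rowP => i.
  by rewrite mxE; apply/eqP; apply: contrapT => /negP/h.
pose F i := `|w 0 i| `^ (r 0 i)^-1.
have [i Fi] : exists i, forall j, F j <= F i.
  by exists [arg max_(i > i0) F i]%O; case: arg_maxP => // i _ h j; exact: h.
have FE j : F j `^ r 0 j = `|w 0 j| by rewrite powR_root.
have m0 : 0 < F i.
  by apply: lt_le_trans (Fi i0); rewrite powR_gt0// normr_gt0.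
have mj j : 0 < F i `^ r 0 j by exact: powR_gt0.
exists (F i), (\row_j (w 0 j / F i `^ r 0 j)), i; split=> //.
- apply/eqP; rewrite eq_le; apply/andP; split.
    apply: rv_norm_le => // j; rewrite mxE normrM [`|_^-1|]gtr0_norm ?invr_gt0//.
    rewrite ler_pdivrMr// mul1r -FE; apply: ler_powR_base => //.
      exact: ltW.
    exact: powR_ge0.
  have := rv_coord_le (\row_j (w 0 j / F i `^ r 0 j)) i; apply: le_trans.
  by rewrite mxE normrM [`|_^-1|]gtr0_norm ?invr_gt0// FE mulfV// -FE gt_eqF.
- by apply/rowP => j; rewrite !mxE mulrC divfK// gt_eqF.
Qed.

Lemma sphere_compact (R : realType) n (a b : R) : 0 < a ->
  compact [set x : 'rV[R]_n | a <= `|x| <= b] /\ ~ [set x : 'rV[R]_n | a <= `|x| <= b] 0.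
Proof.
move=> a0; split; last by rewrite /= normr0 leNgt a0.
rewrite (_ : mkset _ = [set x : 'rV[R]_n | `|x| <= b] `&` [set x | a <= `|x|]); last first.
  by apply/seteqP; split=> x /=; [move=> /andP[]|move=> [-> ->]].
apply: compact_closedI; first exact: closed_ball0_compact.
apply: (@closed_comp _ _ (fun x : 'rV[R]_n => `|x|) [set r | a <= r]).
  by move=> x _; exact: norm_continuous.
exact: closed_ge.
Qed.

(** With degree zero, [phi] would tend to a nonzero value [phi0 x] along the dilations of [x]
    shrinking to the origin, whereas continuity gives the limit [phi 0 = 0]. *)
Lemma degree0_gt0 (R : realType) n (phi phi0 : 'rV[R]_n -> R) (r : 'rV[R]_n) (d : R) :
  homogeneous_0limit phi r d phi0 -> phi 0 = 0 -> phi0 0 = 0 -> 0 < d.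
Proof.
move=> [r0 d0 phic [phi0c [x x0]] lim] phi00 phi000.
rewrite lt_neqAle d0 andbT; apply/eqP => dE; rewrite -dE in lim.
have xn0 : x != 0 by apply: contra x0 => /eqP ->; rewrite phi000.
have e0 : 0 < `|phi0 x| / 3 by rewrite divr_gt0// normr_gt0.
have [h h0 hP] := continuous_delta 0 phic e0.
have [l1 l10 l1P] := dilation_small `|x| r0 h0.
have x1 : ~ [set x] 0 by move=> /= /eqP; rewrite eq_sym (negbTE xn0).
have [l2 l20 l2P] := lim _ (@compact_set1 _ x) x1 _ e0.
pose l := Num.min l1 l2.
have l0 : 0 < l by rewrite lt_min l10.
have := l2P l l0; rewrite ge_min lexx orbT => /(_ isT x erefl).
rewrite powRr0 divr1 => H1.
have := hP (dilation l r x); rewrite subr0 => /(_ _) H2.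
have : `|phi (dilation l r x) - phi 0| <= `|phi0 x| / 3.
  by apply: H2; apply: l1P => //; rewrite ge_min lexx.
rewrite phi00 subr0 => H3.
have := ler_normB (phi (dilation l r x)) (phi (dilation l r x) - phi0 x).
by rewrite subKr; have := normr_gt0 (phi0 x); rewrite x0; lra.
Qed.

(** The behaviour of [phi] at infinity says nothing about the origin, so the argument bears on
    [phiy]: with degree zero it is invariant under dilations, hence, by its continuity at the
    origin, equal to [phiy 0 = 0] everywhere. *)
Lemma degreey_gt0 (R : realType) n (phi phiy : 'rV[R]_n -> R) (r : 'rV[R]_n) (d : R) :
  homogeneous_ylimit phi r d phiy -> phiy 0 = 0 -> 0 < d.
Proof.
move=> [r0 d0 phic [phiyc [x x0]] lim] phiy0.
rewrite lt_neqAle d0 andbT; apply/eqP => dE; rewrite -dE in lim.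
have xn0 : x != 0 by apply: contra x0 => /eqP ->; rewrite phiy0.
have inv m : 0 < m -> phiy (dilation m r x) = phiy x.
  move=> m0; apply/eqP; rewrite -subr_eq0 -normr_le0; apply/ler_addgt0Pr => e e0.
  have e20 : 0 < e / 2 by rewrite divr_gt0.
  have x1 : ~ [set x] 0 by move=> /= /eqP; rewrite eq_sym (negbTE xn0).
  have x2 : ~ [set dilation m r x] 0.
    by move=> /= /eqP; rewrite eq_sym (negbTE (dilation_neq0 _ m0 xn0)).
  have [l1 l10 l1P] := lim _ (@compact_set1 _ x) x1 _ e20.
  have [l2 l20 l2P] := lim _ (@compact_set1 _ (dilation m r x)) x2 _ e20.
  pose l := Num.max (l1 / m) l2.
  have ll2 : l2 <= l by rewrite le_max lexx orbT.
  have ll1 : l1 <= l * m by rewrite -ler_pdivrMr// le_max lexx.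
  have := l2P l ll2 _ erefl; have := l1P _ ll1 _ erefl.
  rewrite dilationM; [|by rewrite (le_trans _ ll2)// ltW|exact: ltW].
  rewrite !powRr0 !divr1 add0r => H1 H2.
  have := ler_distD (phi (dilation l r (dilation m r x))) (phiy (dilation m r x)) (phiy x).
  by rewrite [`|phiy _ - phi _|]distrC; lra.
have e0 : 0 < `|phiy x| / 2 by rewrite divr_gt0// normr_gt0.
have [h h0 hP] := continuous_delta 0 phiyc e0.
have [l1 l10 l1P] := dilation_small `|x| r0 h0.
have := hP (dilation l1 r x); rewrite inv// subr0 phiy0 subr0 => H.
have : `|phiy x| <= `|phiy x| / 2 by apply: H; apply: l1P.
by have := normr_gt0 (phiy x); rewrite x0; lra.
Qed.

Lemma dilation_ball_small (R : realType) n (r : 'rV[R]_n) (eta : R) :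
  is_weight r -> 0 < eta ->
  exists2 k : R, 0 < k & forall w, `|w| <= k -> w != 0 ->
    exists m u, [/\ 0 < m, m <= eta, `|u| = 1 & w = dilation m r u].
Proof.
move=> r0 eta0.
exists (\big[Num.min/1]_i eta `^ r 0 i).
  by apply/bigmin_gtP; split=> // i _; exact: powR_gt0.
move=> w wk w0; have [m [u [i [m0 u1 wE wi]]]] := dilation_sphere r0 w0.
exists m, u; split=> //; apply: (powR_le_inv (r0 i)); [exact: ltW|exact: ltW|].
rewrite -wi (le_trans (rv_coord_le _ _))// (le_trans wk)//.
exact: bigmin_le_cond.
Qed.

(** The definition gives uniformity only on compact sets avoiding the origin. A small [w] is the
    dilation by [m] of a unit vector [u], and the quotient at [w] for scale [l] is [m^d] times the
    quotient at [u] for scale [l * m]; the latter is bounded, and [m^d] is small because the degree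
    is positive. *)
Lemma homogeneous_0limit_uniform (R : realType) n (phi phi0 : 'rV[R]_n -> R)
    (r : 'rV[R]_n) (d B e : R) :
  homogeneous_0limit phi r d phi0 -> phi 0 = 0 -> phi0 0 = 0 -> 0 < e ->
  exists2 h, 0 < h & forall l, 0 < l -> l <= h -> forall w, `|w| <= B ->
    `|phi (dilation l r w) / l `^ d - phi0 w| <= e.
Proof.
move=> hom phi00 phi000 e0; have d0 := degree0_gt0 hom phi00 phi000.
have [r0 _ phic [phi0c _] lim] := hom.
have e20 : 0 < e / 2 by rewrite divr_gt0.
have [A A0 phi0A] := continuous_bounded_ball 1 phi0c.
have [sc s0] := @sphere_compact R n 1 1 ltr01.
have [l1 l10 l1P] := lim _ sc s0 1 ltr01.
have A10 : 0 < A + 1 by rewrite addr_gt0.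
have eA : 0 < e / 2 / (A + 1) by rewrite divr_gt0.
have [eta eta0 etaP] := powR_small d0 eA.
(* [m <= 1] keeps [l * m] below [l1], and [m <= eta] makes the factor [m^d] small. *)
pose eta1 := Num.min 1 eta.
have eta10 : 0 < eta1 by rewrite lt_min ltr01.
have [k1 k10 k1P] := dilation_ball_small r0 eta10.
have [k2 k20 k2P] := continuous_delta 0 phi0c e20.
pose k := Num.min k1 k2; have k0 : 0 < k by rewrite lt_min k10.
have [sc2 s02] := @sphere_compact R n k B k0.
have [l2 l20 l2P] := lim _ sc2 s02 e e0.
exists (Num.min l1 l2); first by rewrite lt_min l10.
move=> l l0; rewrite le_min => /andP[ll1 ll2] w wB.
have [kw|wk] := leP k `|w|; first by apply: l2P => //=; rewrite kw.
have [->|w0] := eqVneq w 0.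
  by rewrite dilation0 phi00 phi000 mul0r subrr normr0 ltW.
move: (ltW wk); rewrite le_min => /andP[wk1 wk2].
have [m [u [m0 meta u1 wE]]] := k1P w wk1 w0.
move: meta; rewrite le_min => /andP[m1 meta].
have phi0w : `|phi0 w| <= e / 2.
  by have := k2P w; rewrite !subr0 phi000 subr0; apply.
suff : `|phi (dilation l r w) / l `^ d| <= e / 2.
  by have := ler_normB (phi (dilation l r w) / l `^ d) (phi0 w); lra.
have lm0 : 0 < l * m by rewrite mulr_gt0.
have lml : l * m <= l1 by rewrite (le_trans _ ll1)// ler_piMr// ltW.
have uS : [set x : 'rV[R]_n | 1 <= `|x| <= 1] u by rewrite /= u1 lexx.
have := l1P _ lm0 lml u uS; rewrite (powRM _ (ltW l0) (ltW m0)) invfM mulrA => h1.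
have h2 : `|phi0 u| <= A by apply: phi0A; rewrite u1.
have h3 : `|phi (dilation (l * m) r u) / l `^ d / m `^ d| <= A + 1.
  have := ler_normD (phi (dilation (l * m) r u) / l `^ d / m `^ d - phi0 u) (phi0 u).
  by rewrite subrK; lra.
have md0 : 0 < m `^ d by exact: powR_gt0.
rewrite wE -(dilationM _ _ (ltW l0) (ltW m0)) -[X in `|X|](divfK (lt0r_neq0 md0)).
rewrite normrM [`|m `^ d|]gtr0_norm//.
have := etaP m m0 meta; rewrite ler_pdivlMr// mulrC => h4.
by apply: le_trans h4; rewrite ler_pM2r.
Qed.

(** Here [l * m] need not be large when [l] is, so the limit on the sphere is replaced by the bound
    [growth], valid at all scales; its constant term [D] is absorbed by a large [l^d]. *)
Lemma homogeneous_ylimit_uniform (R : realType) n (phi phiy : 'rV[R]_n -> R)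
    (r : 'rV[R]_n) (d B e : R) :
  homogeneous_ylimit phi r d phiy -> phiy 0 = 0 -> 0 < e ->
  exists2 h, 0 < h & forall l, h <= l -> forall w, `|w| <= B ->
    `|phi (dilation l r w) / l `^ d - phiy w| <= e.
Proof.
move=> hom phiy0 e0; have d0 := degreey_gt0 hom phiy0.
have [r0 _ phic [phiyc _] lim] := hom.
have e20 : 0 < e / 2 by rewrite divr_gt0.
have [A A0 phiyA] := continuous_bounded_ball 1 phiyc.
have [sc s0] := @sphere_compact R n 1 1 ltr01.
have [l1 l10 l1P] := lim _ sc s0 1 ltr01.
(* [C] bounds the dilations of unit vectors by scales below [l1], hence [D] bounds [phi] on them. *)
pose C := \big[Num.max/1]_i l1 `^ r 0 i.
have [D D0 phiD] := continuous_bounded_ball C phic.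
have growth l u : 0 < l -> `|u| = 1 ->
    `|phi (dilation l r u)| <= D + (A + 1) * l `^ d.
  move=> l0 u1; have ld0 : 0 < l `^ d by exact: powR_gt0.
  have [l1l|ll1] := leP l1 l.
    have uS : [set x : 'rV[R]_n | 1 <= `|x| <= 1] u by rewrite /= u1 lexx.
    have := l1P l l1l u uS => h1.
    have h2 : `|phiy u| <= A by apply: phiyA; rewrite u1.
    have h3 : `|phi (dilation l r u) / l `^ d| <= A + 1.
      have := ler_normD (phi (dilation l r u) / l `^ d - phiy u) (phiy u).
      by rewrite subrK; lra.
    rewrite (@le_trans _ _ ((A + 1) * l `^ d))//; last by rewrite lerDr ltW.
    by move: h3; rewrite normrM [`|_^-1|]gtr0_norm ?invr_gt0// ler_pdivrMr.
  rewrite (@le_trans _ _ D)//; last by rewrite lerDl mulr_ge0 ?ltW// addr_gt0.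
  apply: phiD; apply: rv_norm_le => [|i].
    by rewrite (le_trans ler01)//; exact: bigmax_ge_id.
  rewrite mxE normrM ger0_norm ?powR_ge0//.
  have ui : `|u 0 i| <= 1 by rewrite -u1 rv_coord_le.
  apply: (@le_trans _ _ (l1 `^ r 0 i)); last exact: le_bigmax_cond.
  apply: (@le_trans _ _ (l `^ r 0 i)); first by rewrite ler_piMr// powR_ge0.
  by apply: ler_powR_base => //; exact: ltW.
have A10 : 0 < A + 1 by rewrite addr_gt0.
have eA : 0 < e / 4 / (A + 1) by rewrite !divr_gt0.
have [eta eta0 etaP] := powR_small d0 eA.
have [k1 k10 k1P] := dilation_ball_small r0 eta0.
have [k2 k20 k2P] := continuous_delta 0 phiyc e20.
pose k := Num.min k1 k2; have k0 : 0 < k by rewrite lt_min k10.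
have [sc2 s02] := @sphere_compact R n k B k0.
have [l2 l20 l2P] := lim _ sc2 s02 e e0.
(* Beyond [l3], both [D] and [|phi 0|] are at most a quarter of [e * l^d]. *)
have [l3 l30 l3P] := powR_large (4 * (D + `|phi 0|) / e) d0.
exists (Num.max l2 l3); first by rewrite lt_max l20.
move=> l; rewrite ge_max => /andP[ll2 ll3] w wB.
have l0 : 0 < l by exact: lt_le_trans ll2.
have ld0 : 0 < l `^ d by exact: powR_gt0.
have [kw|wk] := leP k `|w|; first by apply: l2P => //=; rewrite kw.
have := l3P l ll3; rewrite ler_pdivrMr// => lK.
move: (ltW wk); rewrite le_min => /andP[wk1 wk2].
have phiyw : `|phiy w| <= e / 2.
  by have := k2P w; rewrite !subr0 phiy0 subr0; apply.
suff : `|phi (dilation l r w) / l `^ d| <= e / 2.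
  by have := ler_normB (phi (dilation l r w) / l `^ d) (phiy w); lra.
rewrite normrM [`|_^-1|]gtr0_norm ?invr_gt0// ler_pdivrMr//.
have [->|w0] := eqVneq w 0.
  by rewrite dilation0; have := normr_ge0 (phi 0); nra.
have [m [u [m0 meta u1 wE]]] := k1P w wk1 w0.
rewrite wE -(dilationM _ _ (ltW l0) (ltW m0)).
apply: le_trans (growth _ _ (mulr_gt0 l0 m0) u1) _; rewrite (powRM _ (ltW l0) (ltW m0)).
have := etaP m m0 meta; rewrite ler_pdivlMr// mulrC => h4.
have h5 : (A + 1) * m `^ d * l `^ d <= e / 4 * l `^ d by rewrite ler_pM2r.
by rewrite mulrCA mulrC; have := normr_ge0 (phi 0); lra.
Qed.

Lemma continuous_of_components (R : realType) n m
    (F : 'rV[R]_n * 'rV[R]_m -> 'rV[R]_n) :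
  (forall i, continuous (component F i)) -> continuous F.
Proof.
move=> Fc q; apply/cvgrPdist_le => e e0.
have H i : exists2 h, 0 < h & forall l, 0 < l -> l <= h -> forall z,
    `|z - row_mx q.1 q.2| <= l -> `|component F i z - F q 0 i| <= e.
  have [h h0 hP] := continuous_delta (row_mx q.1 q.2) (Fc i) e0.
  exists h => // l l0 lh z zl; have := hP z (le_trans zl lh).
  by rewrite [X in _ - X]/component row_mxKl row_mxKr -surjective_pairing.
have [h h0 hP] := ex_small_all H.
exists (ball q.1 h, ball q.2 h) => /=; first by split; exact: nbhsx_ballx.
move=> z [/=]; rewrite -!ball_normE /= => z1 z2.
apply: rv_norm_le => [|i]; first exact: ltW.
rewrite distrC in z1; rewrite distrC in z2.
rewrite !mxE distrC; have := hP h h0 (lexx _) i (row_mx z.1 z.2).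
rewrite /component row_mxKl row_mxKr -surjective_pairing; apply.
rewrite opp_row_mx add_row_mx; apply: rv_norm_le => [|j]; first exact: ltW.
rewrite mxE; case: fintype.split => k.
  by apply: le_trans (ltW z1); exact: rv_coord_le.
by apply: le_trans (ltW z2); exact: rv_coord_le.
Qed.

(** Each coordinate has its own weight [a i], which is why [trajectory] states the mean value
    inequality coordinate by coordinate; the one for [x] is used with [v] and [K] multiplied by
    [a i / theta]. *)
Lemma trajectory_rescale (R : realType) n (t theta : R) (a : 'I_n -> R)
    (x dx : R -> 'rV[R]_n) :
  0 < theta -> (forall i, 0 < a i) -> trajectory t x dx ->
  trajectory (t / theta) (fun s => \row_i (x (theta * s) 0 i / a i))
    (fun s => \row_i (theta / a i * dx (theta * s) 0 i)).
Proof.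
move=> th0 a0 [xt [C dxC]]; have thN0 := lt0r_neq0 th0; split.
  move=> i p q v K p0 pq qt dK; have aN0 := lt0r_neq0 (a0 i).
  have tp : 0 <= theta * p by rewrite mulr_ge0// ltW.
  have tpq : theta * p <= theta * q by rewrite ler_pM2l.
  have tq : theta * q <= t by rewrite mulrC -ler_pdivlMr.
  have H := xt i _ _ (a i * v / theta) (K * a i / theta) tp tpq tq.
  rewrite !mxE (_ : _ - _ - _ = (x (theta * q) 0 i - x (theta * p) 0 i
    - (theta * q - theta * p) * (a i * v / theta)) / a i); last by field; rewrite aN0 thN0.
  rewrite normrM [`|_^-1|]gtr0_norm ?invr_gt0// ler_pdivrMr//.
  rewrite (_ : K * (q - p) * a i = K * a i / theta * (theta * q - theta * p)); last by field.
  apply: H => s /andP[s1 s2].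
  have := dK (s / theta); rewrite mxE.
  rewrite ler_pdivlMr// ler_pdivrMr// [p * _]mulrC s1 [q * _]mulrC s2 => /(_ isT).
  rewrite [theta * (s / theta)]mulrC divfK// => H.
  have at0 : 0 < a i / theta by rewrite divr_gt0.
  rewrite (_ : dx s 0 i - _ = (theta / a i * dx s 0 i - v) * (a i / theta)); last first.
    by field; rewrite aN0 thN0.
  by rewrite normrM (gtr0_norm at0) -[K * _ / _]mulrA ler_pM2r.
exists (\big[Num.max/0]_i (theta / a i * C)) => s /andP[s0 st].
apply: rv_norm_le => [|i]; first exact: bigmax_ge_id.
apply: (@le_trans _ _ (theta / a i * C)); last exact: le_bigmax_cond.
rewrite mxE normrM gtr0_norm ?divr_gt0// ler_pM2l ?divr_gt0//.
apply: le_trans (rv_coord_le _ _) _; apply: dxC.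
by rewrite mulr_ge0 ?(ltW th0)//= mulrC -ler_pdivlMr.
Qed.

(** The tolerance [c1] of [robust_stability] is shared equally between the error [G - F] and the
    effect of the input on [F]. The main use is with [G] a rescaled [f], close to [F] on bounded
    sets only; [c <= 1] keeps the inputs in such a set. *)
Lemma perturbed_field_stability (R : realType) n m
    (F : 'rV[R]_n * 'rV[R]_m -> 'rV[R]_n) (M e : R) :
  continuous F -> globally_asymptotically_stable (fun y => F (y, 0)) -> 0 < e ->
  exists c L tau k, [/\ 0 < c, c <= 1, 0 < L & 0 < tau] /\ 0 < k /\
    forall G : 'rV[R]_n * 'rV[R]_m -> 'rV[R]_n,
    (forall y d, `|y| <= L -> `|d| <= 1 -> `|G (y, d) - F (y, d)| <= k) ->
    forall t y dy d, 0 <= t -> trajectory t y dy -> `|y 0| <= M ->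
      (forall s, 0 <= s <= t -> dy s = G (y s, d s)) ->
      (forall s, 0 <= s <= t -> `|d s| <= c) ->
      `|y t| <= L /\ (tau <= t -> `|y t| <= e).
Proof.
move=> Fc gas e0; have gc : continuous (fun y => F (y, 0)).
  move=> y; apply: (@cvg_comp _ _ _ (fun y : 'rV[R]_n => (y, 0 : 'rV[R]_m))
    F _ (nbhs ((y, 0) : 'rV[R]_n * 'rV[R]_m))); last exact: Fc.
  have h1 : (fun z : 'rV[R]_n => z) @ y --> y by move=> A hA; exact: hA.
  have h2 : (fun=> 0 : 'rV[R]_m) @ y --> (0 : 'rV[R]_m) by exact: cst_continuous.
  exact: (cvg_pair h1 h2).
have [c1 [L [tau [c10 L0 tau0 rob]]]] := robust_stability M gc gas e0.
have c120 : 0 < c1 / 2 by rewrite divr_gt0.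
have [c2 c20 c2P] := continuous_uniform_perturbation L Fc c120.
exists (Num.min 1 c2), L, tau, (c1 / 2); split; [split|split] => //.
- by rewrite lt_min ltr01.
- by rewrite ge_min lexx.
move=> G GF t y dy d t0 ty y0 dyG dc; apply: rob t0 ty y0 _ => s st yL.
have := dc s st; rewrite le_min => /andP[d1 d2]; rewrite dyG//.
have h1 := GF _ _ yL d1; have h2 := c2P _ _ yL d2.
have := ler_normD (G (y s, d s) - F (y s, d s)) (F (y s, d s) - F (y s, 0)).
by rewrite addrA subrK; lra.
Qed.

Lemma dilation_row_mx (R : realType) n m (l : R) (r y : 'rV[R]_n) (s d : 'rV[R]_m) :
  dilation l (row_mx r s) (row_mx y d) = row_mx (dilation l r y) (dilation l s d).
Proof.
by apply/rowP => i; rewrite !mxE; case: fintype.split => j; rewrite mxE. Qed.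

(** For the rescaled state [y] and input [eta], with time in units of [theta], the system reads
    [dy = G (y, eta)], where the components of [G] are exactly the quotients in the definition of
    homogeneity. The constants come from [F] alone, so they hold at every scale where [f] is close
    to [F]. *)
Lemma scaled_field_stability (R : realType) n m
    (f F : 'rV[R]_n * 'rV[R]_m -> 'rV[R]_n) (r : 'rV[R]_n) (s : 'rV[R]_m) (deg e : R) :
  continuous F -> globally_asymptotically_stable (fun y => F (y, 0)) -> 0 < e ->
  exists c L tau k, [/\ 0 < c, 0 < L, 0 < tau & 0 < k] /\ exists B : R,
    forall l, 0 < l ->
    (forall i w, `|w| <= B -> `|component f i (dilation l (row_mx r s) w) /
       l `^ (deg + r 0 i) - component F i w| <= k) ->
    forall t x dx d, 0 <= t -> trajectory t x dx ->
      (forall q, 0 <= q <= t -> dx q = f (x q, d q)) ->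
      (forall i, `|x 0 0 i| <= l `^ r 0 i) ->
      (forall q, 0 <= q <= t -> forall i, `|d q 0 i| <= c * l `^ s 0 i) ->
      forall i, `|x t 0 i| <= L * l `^ r 0 i /\
        (tau / l `^ deg <= t -> `|x t 0 i| <= e * l `^ r 0 i).
Proof.
move=> Fc gas e0.
have [c [L [tau [k [[c0 c1 L0 tau0] [k0 H]]]]]] := perturbed_field_stability 1 Fc gas e0.
exists c, L, tau, k; split=> //; exists (Num.max L 1) => l l0 fF.
move=> t x dx d t0 tx dxf x0 dc.
have lp a : 0 < l `^ a by exact: powR_gt0.
pose theta := (l `^ deg)^-1; have th0 : 0 < theta by rewrite invr_gt0.
have thN0 := lt0r_neq0 th0.
pose y q := \row_i (x (theta * q) 0 i / l `^ r 0 i).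
pose eta q := \row_i (d (theta * q) 0 i / l `^ s 0 i).
pose dy q := \row_i (theta / l `^ r 0 i * dx (theta * q) 0 i).
pose G (w : 'rV[R]_n * 'rV[R]_m) : 'rV[R]_n :=
  \row_i (component f i (dilation l (row_mx r s) (row_mx w.1 w.2)) / l `^ (deg + r 0 i)).
have ty : trajectory (t / theta) y dy by exact: trajectory_rescale.
have GF z v : `|z| <= L -> `|v| <= 1 -> `|G (z, v) - F (z, v)| <= k.
  move=> zL v1; apply: rv_norm_le => [|i]; first exact: ltW.
  have := fF i (row_mx z v); rewrite !mxE /= /component row_mxKl row_mxKr; apply.
  apply: rv_norm_le => [|j]; first by rewrite le_max ltW.
  rewrite mxE le_max; case: fintype.split => j'; apply/orP; [left|right].
    by rewrite (le_trans (rv_coord_le _ _)).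
  by rewrite (le_trans (rv_coord_le _ _)).
have qt q : 0 <= q <= t / theta -> 0 <= theta * q <= t.
  by move=> /andP[q0 qt]; rewrite mulr_ge0 ?(ltW th0)//= mulrC -ler_pdivlMr.
have [||||yL ye] := H _ GF (t / theta) y dy eta _ ty.
- by rewrite divr_ge0// ltW.
- apply: rv_norm_le => // i; rewrite mxE mulr0 normrM [`|_^-1|]gtr0_norm ?invr_gt0//.
  by rewrite ler_pdivrMr// mul1r.
- move=> q /qt tq; apply/rowP => i; rewrite !mxE dxf// /component /= dilation_row_mx.
  rewrite row_mxKl row_mxKr.
  rewrite (_ : dilation l r (y q) = x (theta * q)); last first.
    by apply/rowP => j; rewrite !mxE mulrC divfK// lt0r_neq0.
  rewrite (_ : dilation l s (eta q) = d (theta * q)); last first.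
    by apply/rowP => j; rewrite !mxE mulrC divfK// lt0r_neq0.
  rewrite mulrC powRD ?(gt_eqF l0) ?implybT// /theta invfM.
  by [].
- move=> q /qt tq; apply: rv_norm_le => [|i]; first exact: ltW.
  rewrite mxE normrM [`|_^-1|]gtr0_norm ?invr_gt0// ler_pdivrMr//; exact: dc.
have yt i : `|x t 0 i| <= `|y (t / theta)| * l `^ r 0 i.
  have := rv_coord_le (y (t / theta)) i.
  rewrite mxE [theta * _]mulrC divfK// normrM [`|_^-1|]gtr0_norm ?invr_gt0//.
  by rewrite ler_pdivrMr.
move=> i; split.
  by apply: le_trans (yt i) _; rewrite ler_pM2r.
move=> taut; apply: le_trans (yt i) _; rewrite ler_pM2r//; apply: ye.
by rewrite ler_pdivlMr.
Qed.

(** * Contraction at every scale *)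

Lemma one_powR (R : realType) (a : R) : 1 `^ a = 1.
Proof. by rewrite powR1. Qed.

Definition biscale (R : realType) N (r ry : 'rV[R]_N) (l : R) (i : 'I_N) : R :=
  if l <= 1 then l `^ r 0 i else l `^ ry 0 i.

Lemma biscale_gt0 (R : realType) N (r ry : 'rV[R]_N) (l : R) i :
  0 < l -> 0 < biscale r ry l i.
Proof. by move=> l0; rewrite /biscale; case: ifP => _; exact: powR_gt0. Qed.

(** Both branches equal [1] at [l = 1], which glues the two monotone pieces. *)
Lemma biscale_le (R : realType) N (r ry : 'rV[R]_N) (l l' : R) i :
  is_weight r -> is_weight ry -> 0 < l -> l <= l' ->
  biscale r ry l i <= biscale r ry l' i.
Proof.
move=> r0 ry0 l0 ll'; have l'0 := lt_le_trans l0 ll'.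
rewrite /biscale; have [l'1|l'1] := leP l' 1.
  by rewrite (le_trans ll' l'1) ler_powR_base// ltW.
have [l1|l1] := leP l 1; last by rewrite ler_powR_base// ltW.
apply: (@le_trans _ _ 1).
  by rewrite -[leRHS](one_powR (r 0 i)) ler_powR_base// ltW.
by rewrite -[leLHS](one_powR (ry 0 i)) ler_powR_base// ltW.
Qed.

Lemma biscale_small (R : realType) N (r ry : 'rV[R]_N) (e : R) :
  is_weight r -> 0 < e -> exists2 h, 0 < h & forall i, biscale r ry h i <= e.
Proof.
move=> r0 e0; have [h h0 hP] := ex_small_all (fun i => powR_small (r0 i) e0).
have h10 : 0 < Num.min h 1 by rewrite lt_min h0 ltr01.
exists (Num.min h 1) => // i; rewrite /biscale ge_min lexx orbT.
by apply: hP => //; rewrite ge_min lexx.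
Qed.

Lemma biscale_large (R : realType) N (r ry : 'rV[R]_N) (K : R) :
  is_weight ry ->
  exists2 h, 0 < h & forall l, h <= l -> forall i, K <= biscale r ry l i.
Proof.
move=> ry0; have H i : exists h, forall l, h <= l -> K <= l `^ ry 0 i.
  by have [h _ hP] := powR_large K (ry0 i); exists h.
have [h h0 hP] := ex_large_all H.
exists (Num.max h 2); first by rewrite lt_max h0.
move=> l; rewrite ge_max => /andP[hl l2] i; rewrite /biscale [l <= 1]leNgt.
by rewrite (_ : 1 < l) /=; [exact: hP|lra].
Qed.

Lemma component0 (R : realType) n m (f : 'rV[R]_n * 'rV[R]_m -> 'rV[R]_n) i :
  f (0, 0) = 0 -> component f i 0 = 0.
Proof.
move=> f0; rewrite /component (_ : (_, _) = (0, 0)) ?f0 ?mxE//.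
by congr (_, _); apply/rowP => j; rewrite !mxE.
Qed.

(** Only [tau] depends on [l]; [c] and [L] are the worst of three pairs of constants, for scales
    near zero, near infinity and in between. *)
Lemma scale_contraction (R : realType) (n m : nat)
  (f f0 fy : 'rV[R]_n * 'rV[R]_m -> 'rV[R]_n)
  (r0 ry : 'rV[R]_n) (s0 sy : 'rV[R]_m) (d0 dy : R) :
  is_weight r0 -> is_weight ry -> is_weight s0 -> is_weight sy ->
  continuous f -> vf_homogeneous_bilimit f r0 s0 d0 f0 ry sy dy fy ->
  globally_asymptotically_stable (fun x => f (x, 0)) ->
  globally_asymptotically_stable (fun x => f0 (x, 0)) ->
  globally_asymptotically_stable (fun x => fy (x, 0)) ->
  exists c L, [/\ 0 < c, 1 <= L & forall l, 0 < l -> exists2 tau, 0 < tau &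
    forall t x dx d, 0 <= t -> trajectory t x dx ->
      (forall q, 0 <= q <= t -> dx q = f (x q, d q)) ->
      (forall i, `|x 0 0 i| <= biscale r0 ry l i) ->
      (forall q, 0 <= q <= t -> forall i, `|d q 0 i| <= c * biscale s0 sy l i) ->
      forall i, `|x t 0 i| <= L * biscale r0 ry l i /\
        (tau <= t -> `|x t 0 i| <= biscale r0 ry (l / 2) i)].
Proof.
move=> r00 ry0 s00 sy0 fc hom fgas f0gas fygas.
have hom0 i := (hom i).1; have homy i := (hom i).2.
have f0c : continuous f0 by apply: continuous_of_components => i; case: (hom0 i) => _ _ _ [].
have fyc : continuous fy by apply: continuous_of_components => i; case: (homy i) => _ _ _ [].
have [f00 f000 fy00] : [/\ f (0, 0) = 0, f0 (0, 0) = 0 & fy (0, 0) = 0].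
  by split; [case: fgas|case: f0gas|case: fygas].
(* Halving the scale multiplies the size of coordinate [i] by a power of [2^-1] depending on [i];
   this [e] is small enough for all coordinates. *)
have half (r : 'rV[R]_n) : exists2 e : R, 0 < e & forall i : 'I_n, e <= 2^-1 `^ r 0 i.
  exists (\big[Num.min/1]_i 2^-1 `^ r 0 i).
    by apply/bigmin_gtP; split=> // i _; apply: powR_gt0; rewrite invr_gt0.
  by move=> i; exact: bigmin_le_cond.
have [e0 e00 e0P] := half r0; have [ey ey0 eyP] := half ry.
have [c0 [L0 [tau0 [k0 [[c00 L00 tau00 k00] [B0 H0]]]]]] :=
  scaled_field_stability f r0 s0 d0 f0c f0gas e00.
have [cy [Ly [tauy [ky [[cy0 Ly0 tauy0 ky0] [By Hy]]]]]] :=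
  scaled_field_stability f ry sy dy fyc fygas ey0.
have [h0 h00 h0P] := ex_small_all (fun i => homogeneous_0limit_uniform B0 (hom0 i)
  (component0 i f00) (component0 i f000) k00).
have [hy hy0 hyP] : exists2 h, 0 < h & forall l, h <= l -> forall i w, `|w| <= By ->
    `|component f i (dilation l (row_mx ry sy) w) / l `^ (dy + ry 0 i)
      - component fy i w| <= ky.
  apply: ex_large_all => i.
  have [h _ hP] := homogeneous_ylimit_uniform By (homy i) (component0 i fy00) ky0.
  by exists h.
(* [l0 <= 1] and [2 <= ly] let [l] and [l / 2] use the same branch of [biscale]; at [l / 2 = 1] the
   branches agree. *)
pose l0 := Num.min h0 1; pose ly := Num.max hy 2.
have l00 : 0 < l0 by rewrite lt_min h00 ltr01.
have ly0 : 0 < ly by rewrite lt_max hy0.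
pose w := biscale r0 ry; pose v := biscale s0 sy.
(* Extreme sizes for scales between [l0] and [ly]: [M] and [V] bound states and inputs from above,
   [W] bounds the state sizes from below, and [em] the sizes to be reached after halving. *)
pose M := \big[Num.max/1]_i w ly i.
pose V := \big[Num.max/1]_i v ly i.
pose em := \big[Num.min/1]_i w (l0 / 2) i.
pose W := \big[Num.min/1]_i w l0 i.
have wM i : w ly i <= M by exact: le_bigmax_cond.
have vV i : v ly i <= V by exact: le_bigmax_cond.
have M0 : 0 < M by rewrite (lt_le_trans ltr01)//; exact: bigmax_ge_id.
have V0 : 0 < V by rewrite (lt_le_trans ltr01)//; exact: bigmax_ge_id.
have l020 : 0 < l0 / 2 by rewrite divr_gt0.
have em0 : 0 < em by apply/bigmin_gtP; split=> // i _; exact: biscale_gt0.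
have W0 : 0 < W by apply/bigmin_gtP; split=> // i _; exact: biscale_gt0.
have emw i : em <= w (l0 / 2) i by exact: bigmin_le_cond.
have Ww i : W <= w l0 i by exact: bigmin_le_cond.
have [cm [Lm [taum [km [[cm0 _ Lm0 taum0] [km0 Hm]]]]]] :=
  perturbed_field_stability M fc fgas em0.
(* Inputs within [cm / V] times their scale are at most [cm], and a state at most [Lm] is within
   [Lm / W] times its scale. *)
exists (Num.min (Num.min c0 cy) (cm / V)),
  (Num.max (Num.max (Num.max L0 Ly) (Lm / W)) 1); split.
- by rewrite !lt_min c00 cy0 divr_gt0.
- by rewrite le_max lexx orbT.
set c := Num.min _ _; set L := Num.max _ 1.
have [cc0 ccy ccm] : [/\ c <= c0, c <= cy & c <= cm / V].
  by rewrite /c !ge_min !lexx ?orbT.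
have [LL0 LLy LLm] : [/\ L0 <= L, Ly <= L & Lm / W <= L].
  by rewrite /L !le_max !lexx ?orbT.
move=> l lp; have [ll0|l0l] := leP l l0.
  have l1 : l <= 1 by rewrite (le_trans ll0)// ge_min lexx orbT.
  have lh : l <= h0 by rewrite (le_trans ll0)// ge_min lexx.
  exists (tau0 / l `^ d0); first by rewrite divr_gt0// powR_gt0.
  move=> t x dx d t0 tx dxf x0 dc i.
  have wE j : w l j = l `^ r0 0 j by rewrite /w /biscale l1.
  have vE j : v l j = l `^ s0 0 j by rewrite /v /biscale l1.
  have [||xL xe] := H0 l lp (h0P l lp lh) t x dx d t0 tx dxf _ _ i.
  - by move=> j; rewrite -wE; exact: x0.
  - move=> q qt j; apply: le_trans (dc q qt j) _.
    by rewrite -/v vE ler_wpM2r// powR_ge0.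
  rewrite -/w wE; split; first by rewrite (le_trans xL)// ler_wpM2r// powR_ge0.
  move=> /xe/le_trans; apply; rewrite /w /biscale (_ : l / 2 <= 1); last lra.
  by rewrite powRM ?(ltW lp)// mulrC ler_pM2l ?powR_gt0.
have [lyl|lly] := leP ly l.
  have hl : hy <= l by rewrite (le_trans _ lyl)// le_max lexx.
  have l2 : 2 <= l by rewrite (le_trans _ lyl)// le_max lexx orbT.
  have l1 : (l <= 1) = false by apply/negbTE; rewrite -ltNge; lra.
  exists (tauy / l `^ dy); first by rewrite divr_gt0// powR_gt0.
  move=> t x dx d t0 tx dxf x0 dc i.
  have wE j : w l j = l `^ ry 0 j by rewrite /w /biscale l1.
  have vE j : v l j = l `^ sy 0 j by rewrite /v /biscale l1.
  have [||xL xe] := Hy l lp (hyP l hl) t x dx d t0 tx dxf _ _ i.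
  - by move=> j; rewrite -wE; exact: x0.
  - move=> q qt j; apply: le_trans (dc q qt j) _.
    by rewrite -/v vE ler_wpM2r// powR_ge0.
  rewrite -/w wE; split; first by rewrite (le_trans xL)// ler_wpM2r// powR_ge0.
  move=> /xe/le_trans; apply.
  have -> : w (l / 2) i = (l / 2) `^ ry 0 i.
    rewrite /w /biscale; have [l21|//] := leP (l / 2) 1.
    by rewrite (_ : l / 2 = 1) ?one_powR//; lra.
  by rewrite powRM ?(ltW lp)// mulrC ler_pM2l ?powR_gt0.
exists taum => // t x dx d t0 tx dxf x0 dc i.
have [||||xL xe] := Hm f _ t x dx d t0 tx.
- by move=> y e _ _; rewrite subrr normr0 ltW.
- apply: rv_norm_le => [|j]; first exact: ltW.
  apply: le_trans (x0 j) _; apply: le_trans (wM j); apply: biscale_le => //.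
  exact: ltW.
- by [].
- move=> q qt; apply: rv_norm_le => [|j]; first exact: ltW.
  apply: le_trans (dc q qt j) _; apply: (@le_trans _ _ (cm / V * V)); last by rewrite divfK ?gt_eqF.
  apply: ler_pM => //; first by rewrite !le_min !ltW// divr_gt0.
    by rewrite ltW// biscale_gt0.
  by apply: le_trans (vV j); apply: biscale_le => //; exact: ltW.
split.
  apply: le_trans (rv_coord_le _ _) _; apply: le_trans xL _.
  apply: (@le_trans _ _ (Lm / W * W)); first by rewrite divfK ?gt_eqF.
  apply: ler_pM => //; [by rewrite divr_ge0 ?ltW|exact: ltW|].
  by apply: le_trans (Ww i) _; apply: biscale_le => //; exact: ltW.
move=> taumt; apply: le_trans (rv_coord_le _ _) _.
apply: le_trans (xe taumt) _; apply: le_trans (emw i) _; apply: biscale_le => //.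
by rewrite ler_pM2r ?invr_gt0// ltW.
Qed.

(** * A class KL majorant *)

Definition clip (R : realType) (x : R) : R := Num.max 0 (Num.min 1 x).

Lemma clip_ge0 (R : realType) (x : R) : 0 <= clip x.
Proof. by rewrite /clip le_max lexx. Qed.

Lemma clip_le1 (R : realType) (x : R) : clip x <= 1.
Proof. by rewrite /clip ge_max ler01 ge_min lexx. Qed.

Lemma clip1 (R : realType) : clip (1 : R) = 1.
Proof. by rewrite /clip minxx max_r. Qed.

Lemma clip_eq0 (R : realType) (x : R) : x <= 0 -> clip x = 0.
Proof. by move=> x0; rewrite /clip min_r ?max_l// (le_trans x0). Qed.

Lemma clip_lipschitz (R : realType) (x y e : R) :
  0 <= e -> y <= x + e -> clip y <= clip x + e.
Proof.
move=> e0 yx; rewrite /clip ge_max; apply/andP; split.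
  by rewrite addr_ge0// le_max lexx.
have [x1|x1] := leP 1 x.
  by rewrite (_ : Num.max 0 1 = 1) ?max_r// ge_min lerDl e0.
apply: (@le_trans _ _ (x + e)); first by rewrite ge_min yx orbT.
by rewrite lerD2r le_max lexx orbT.
Qed.

Lemma clip_le (R : realType) (x y : R) : y <= x -> clip y <= clip x.
Proof. by move=> yx; have := @clip_lipschitz R x y 0; rewrite !addr0; exact. Qed.

(* [A a b v] reads: from size [a], after time [b], the value [v] can be reached.  The
   envelope is the sup-convolution of [A] with a kernel Lipschitz in [ln r] and in [t]. *)
Definition envelope_set (R : realType) (A : R -> R -> R -> Prop) (r t : R) : set R :=
  [set x | x = 0 \/ exists a b v,
    A a b v /\ x = v * (clip (2 - a / r) * clip (1 + b - t))].

(** The kernel divides by [r]; at [r = 0] the value is the limit that smallness of [A] near the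
    origin will force. *)
Definition envelope (R : realType) (A : R -> R -> R -> Prop) (r t : R) : R :=
  if 0 < r then sup (envelope_set A r t) else 0.

Definition locally_bounded_graph (R : realType) (A : R -> R -> R -> Prop) : Prop :=
  (forall a b v, A a b v -> 0 <= a /\ 0 <= v) /\
  (forall r, exists M, forall a b v, A a b v -> a <= r -> v <= M).

(** The kernel vanishes for [a >= 2 * r] and for [t >= b + 1], so only the remaining triples
    count. *)
Lemma envelope_set_bounded (R : realType) (A : R -> R -> R -> Prop) r t e :
  locally_bounded_graph A -> 0 < r -> 0 <= e ->
  (forall a b v, A a b v -> a <= 2 * r -> t - 1 <= b -> v <= e) ->
  ubound (envelope_set A r t) e.
Proof.
move=> lbA; have [A0 A_bounded] := lbA.
move=> r0 e0 Ae x [->//|[a [b [v [Aabv ->]]]]].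
have [ar|ra] := leP a (2 * r); last first.
  rewrite clip_eq0 ?mul0r ?mulr0//.
  by rewrite subr_le0 ler_pdivlMr// ltW.
have [bt|tb] := leP (t - 1) b; last first.
  by rewrite [clip (1 + b - t)]clip_eq0 ?mulr0 ?mulr0//; lra.
apply: le_trans (Ae _ _ _ Aabv ar bt).
rewrite ler_piMr ?(proj2 (A0 _ _ _ Aabv))//.
by rewrite mulr_ile1 ?clip_ge0 ?clip_le1.
Qed.

Lemma envelope_set_sup (R : realType) (A : R -> R -> R -> Prop) r t :
  locally_bounded_graph A -> 0 < r -> has_sup (envelope_set A r t).
Proof.
move=> lbA; have [A0 A_bounded] := lbA.
move=> r0; split; first by exists 0; left.
have [M MP] := A_bounded (2 * r); exists (Num.max 0 M).
apply: envelope_set_bounded => //; first by rewrite le_max lexx.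
by move=> a b v Aabv ar _; rewrite le_max (MP _ _ _ Aabv ar) orbT.
Qed.

Lemma envelope_ge0 (R : realType) (A : R -> R -> R -> Prop) r t :
  locally_bounded_graph A -> 0 <= envelope A r t.
Proof.
move=> lbA; have [A0 A_bounded] := lbA.
rewrite /envelope; case: ifP => // r0.
by apply: sup_upper_bound; [exact: envelope_set_sup|left].
Qed.

Lemma envelope_le (R : realType) (A : R -> R -> R -> Prop) r t e :
  locally_bounded_graph A -> 0 <= e ->
  (forall a b v, A a b v -> a <= 2 * r -> t - 1 <= b -> v <= e) ->
  envelope A r t <= e.
Proof.
move=> lbA; have [A0 A_bounded] := lbA.
move=> e0 Ae; rewrite /envelope; case: ifP => // r0.
apply: ge_sup; first by exists 0; left.
exact: envelope_set_bounded.
Qed.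

Lemma envelope_mem (R : realType) (A : R -> R -> R -> Prop) r t a b v :
  locally_bounded_graph A -> 0 < r -> A a b v ->
  v * (clip (2 - a / r) * clip (1 + b - t)) <= envelope A r t.
Proof.
move=> lbA; have [A0 A_bounded] := lbA.
move=> r0 Aabv; rewrite /envelope r0; apply: sup_upper_bound.
  exact: envelope_set_sup.
by right; exists a, b, v.
Qed.

Lemma envelope_le_envelope (R : realType) (A : R -> R -> R -> Prop) r r' t t' e :
  locally_bounded_graph A -> 0 < r' -> 0 <= e ->
  (forall a b v, A a b v ->
    v * (clip (2 - a / r) * clip (1 + b - t)) <=
    v * (clip (2 - a / r') * clip (1 + b - t')) + e) ->
  envelope A r t <= envelope A r' t' + e.
Proof.
move=> lbA; have [A0 A_bounded] := lbA.
move=> r'0 e0 H; have p0 : 0 <= envelope A r' t' + e by rewrite addr_ge0// envelope_ge0.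
rewrite {1}/envelope; case: ifP => // r0.
apply: ge_sup; first by exists 0; left.
move=> x [->//|[a [b [v [Aabv ->]]]]].
by rewrite (le_trans (H _ _ _ Aabv))// lerD2r envelope_mem.
Qed.

Lemma envelope_monotone (R : realType) (A : R -> R -> R -> Prop) r r' t t' :
  locally_bounded_graph A -> 0 <= r -> r <= r' -> t' <= t ->
  envelope A r t <= envelope A r' t'.
Proof.
move=> lbA; have [A0 A_bounded] := lbA.
move=> r0 rr tt; have [r'0|r'0] := ltP 0 r'; last first.
  by rewrite {1}/envelope ltNge (le_trans rr r'0)/= envelope_ge0.
move: r0; rewrite le_eqVlt => /orP[/eqP <-|r0].
  by rewrite {1}/envelope ltxx envelope_ge0.
rewrite -[leRHS]addr0; apply: envelope_le_envelope => // a b v Aabv.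
rewrite addr0 ler_wpM2l ?(proj2 (A0 _ _ _ Aabv))// ler_pM ?clip_ge0//; apply: clip_le.
  by rewrite lerD2l lerN2 ler_wpM2l ?(proj1 (A0 _ _ _ Aabv))// lef_pV2.
by rewrite lerD2l lerN2.
Qed.

(** The first factor of the kernel is Lipschitz in [r] only away from [r = 0], hence the band. In it
    [2 * r <= 8 * rho], so [M] bounds all the values that count, and [a / r1 / r2 <= 8 / rho]. *)
Lemma envelope_lipschitz (R : realType) (A : R -> R -> R -> Prop) rho M r1 r2 t1 t2 :
  locally_bounded_graph A -> 0 < rho ->
  (forall a b v, A a b v -> a <= 8 * rho -> v <= M) -> 0 <= M ->
  rho <= r1 <= 4 * rho -> rho <= r2 <= 4 * rho ->
  envelope A r1 t1 <= envelope A r2 t2 + M * (8 / rho * `|r1 - r2| + `|t1 - t2|).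
Proof.
move=> lbA; have [A0 A_bounded] := lbA.
move=> rho0 AM M0 /andP[r1l r1u] /andP[r2l r2u].
have r10 := lt_le_trans rho0 r1l; have r20 := lt_le_trans rho0 r2l.
have D0 : 0 <= 8 / rho * `|r1 - r2| by rewrite mulr_ge0// divr_ge0// ltW.
apply: envelope_le_envelope => //; first by rewrite mulr_ge0// addr_ge0.
move=> a b v Aabv; have [a0 v0] := A0 _ _ _ Aabv.
have [ar|ra] := leP a (8 * rho); last first.
  rewrite [clip (2 - a / r1)]clip_eq0 ?mul0r ?mulr0.
    rewrite addr_ge0// ?mulr_ge0 ?clip_ge0// addr_ge0//.
  by rewrite subr_le0 ler_pdivlMr//; lra.
have k1 : clip (2 - a / r1) <= clip (2 - a / r2) + 8 / rho * `|r1 - r2|.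
  apply: clip_lipschitz => //.
  suff : a / r2 - a / r1 <= 8 / rho * `|r1 - r2| by lra.
  rewrite (_ : _ - _ = a / r1 / r2 * (r1 - r2)); last first.
    by field; rewrite !gt_eqF.
  have q0 : 0 <= a / r1 / r2 by rewrite !divr_ge0// ltW.
  apply: (@le_trans _ _ (a / r1 / r2 * `|r1 - r2|)).
    by rewrite ler_wpM2l// ler_norm.
  rewrite ler_wpM2r// ler_pM//; first by rewrite divr_ge0// ltW.
  - by rewrite invr_ge0 ltW.
  - by rewrite ler_pdivrMr//; lra.
  - by rewrite lef_pV2.
have k2 : clip (1 + b - t1) <= clip (1 + b - t2) + `|t1 - t2|.
  by apply: clip_lipschitz => //; have := ler_norm (t2 - t1); rewrite distrC; lra.
have := AM _ _ _ Aabv ar.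
have := clip_ge0 (2 - a / r2); have := clip_ge0 (1 + b - t1).
have := clip_le1 (2 - a / r2); have := clip_le1 (1 + b - t1).
have t120 := normr_ge0 (t1 - t2).
move: k1 k2 D0 t120; move: (8 / rho * _) `|t1 - t2| => D T k1 k2 D0 T0.
move: (clip (2 - a / r1)) (clip (2 - a / r2)) (clip (1 + b - t1)) (clip (1 + b - t2)) k1 k2 => p q u w.
move=> pq uw u1 q1 u0 q0 vM.
have h1 : p * u <= (q + D) * u by rewrite ler_wpM2r.
have h2 : q * u <= q * (w + T) by rewrite ler_wpM2l.
have h3 : D * u <= D by rewrite ler_piMr.
have h4 : q * T <= T by rewrite ler_piMl.
have h5 : p * u <= q * w + (D + T) by lra.
apply: (@le_trans _ _ (v * (q * w + (D + T)))); first by rewrite ler_wpM2l.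
by rewrite mulrDr lerD2l ler_wpM2r// addr_ge0.
Qed.

(** Smallness of [A] near the origin makes the envelope continuous at [r = 0], and its decay in time
    gives the limit in [t]. The added term [r / (1 + t)] makes the majorant strictly increasing in
    [r]. *)
Lemma class_KL_majorant (R : realType) (A : R -> R -> R -> Prop) :
  locally_bounded_graph A -> (forall a b v, A a b v -> 0 <= b) ->
  (forall e, 0 < e -> exists2 r, 0 < r & forall a b v, A a b v -> a <= r -> v <= e) ->
  (forall r e, 0 < e ->
     exists tau, forall a b v, A a b v -> a <= r -> tau <= b -> v <= e) ->
  exists2 beta, class_KL beta & forall a b v, A a b v -> v <= beta a b.
Proof.
move=> lbA A_time A_small A_tends; have [A0 A_bounded] := lbA.
pose beta r t := envelope A r t + r / (1 + t).
have env_cont r t e : 0 <= r -> 0 < e -> exists2 h, 0 < h &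
    forall r' t', 0 <= r' -> `|r - r'| < h -> `|t - t'| < h ->
    `|envelope A r t - envelope A r' t'| <= e.
  rewrite le_eqVlt => /orP[/eqP <-|r0] e0.
    have [k k0 kP] := A_small e e0.
    exists (k / 2); first by rewrite divr_gt0.
    move=> r' t' r'0; rewrite sub0r normrN ger0_norm// => r'k _.
    rewrite {1}/envelope ltxx sub0r normrN ger0_norm ?envelope_ge0//.
    apply: envelope_le => //; first exact: ltW.
    by move=> a b v /kP h ar _; apply: h; lra.
  (* The Lipschitz bound is used with [rho = r / 2]: a point closer to [r] than [r / 2] lies between
     [rho] and [4 * rho]. *)
  have [M0 MP] := A_bounded (8 * (r / 2)).
  pose M := Num.max 1 M0; have M1 : 1 <= M by rewrite le_max lexx.
  have M_gt0 : 0 < M by exact: lt_le_trans M1.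
  have AM a b v : A a b v -> a <= 8 * (r / 2) -> v <= M.
    by move=> Aabv ar; rewrite le_max (MP _ _ _ Aabv ar) orbT.
  pose K := 8 / (r / 2) + 1.
  have K0 : 0 < K by rewrite addr_gt0// !divr_gt0.
  have r20 : 0 < r / 2 by rewrite divr_gt0.
  exists (Num.min (r / 2) (e / (M * K))).
    by rewrite lt_min r20 divr_gt0// mulr_gt0.
  move=> r' t' r'0; rewrite !lt_min => /andP[rr1 rr2] /andP[_ tt].
  have rb : r / 2 <= r <= 4 * (r / 2) by apply/andP; split; lra.
  have r'b : r / 2 <= r' <= 4 * (r / 2).
    by move: rr1; rewrite ltr_norml => /andP[? ?]; apply/andP; split; lra.
  have bound : M * (8 / (r / 2) * `|r - r'| + `|t - t'|) <= e.
    rewrite mulrC -ler_pdivlMr//.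
    apply: (@le_trans _ _ (8 / (r / 2) * (e / (M * K)) + e / (M * K))).
      apply: lerD; last exact: ltW.
      by apply: ler_wpM2l; [rewrite divr_ge0// ltW|exact: ltW].
    rewrite (_ : _ + _ = K * (e / (M * K))); last first.
      by move: (e / (M * K)) => q; rewrite /K [RHS]mulrDl mul1r.
    by rewrite invfM mulrCA [K * _]mulrCA divff ?gt_eqF// mulr1 lexx.
  have h1 := envelope_lipschitz t t' lbA r20 AM (ltW M_gt0) rb r'b.
  have h2 := envelope_lipschitz t' t lbA r20 AM (ltW M_gt0) r'b rb.
  rewrite [`|r' - r|]distrC [`|t' - t|]distrC in h2.
  by rewrite ler_norml; apply/andP; split; lra.
have beta_cont : {within [set q : R * R | 0 <= q.1 /\ 0 <= q.2],
    continuous (fun q : R * R => beta q.1 q.2)}.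
  apply/subspace_continuousP => -[r t] [/= r0 t0].
  apply: cvgD; last first.
    apply: cvg_within_filter.
    apply: cvgM; first exact: cvg_fst.
    apply: cvgV; first by rewrite gt_eqF// ltr_pwDl.
    by apply: cvgD; [exact: cvg_cst|exact: cvg_snd].
  apply/cvgrPdist_le => e e0; rewrite near_withinE.
  have [h h0 hP] := env_cont r t e r0 e0.
  exists (ball r h, ball t h) => /=; first by split; exact: nbhsx_ballx.
  move=> [r' t'] /= [rr tt] [r'0 _]; apply: hP => //.
exists beta.
  split=> //.
  - move=> t t0; split.
    + apply/subspace_continuousP => r /= r0.
      have /subspace_continuousP /(_ (r, t)) := beta_cont.
      move=> /(_ (conj r0 t0)) /cvgrPdist_le H; apply/cvgrPdist_le => e e0.
      have := H e e0; rewrite !near_withinE => -[[P Q] /= [rP tQ] PQ].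
      apply: filterS rP => r' Pr' r'0; apply: (PQ (r', t)) => /=; last by split.
      by split=> //; exact: nbhs_singleton.
    + by rewrite /beta /envelope ltxx mul0r addr0.
    + move=> a b a0 ab; apply: ler_ltD.
        by apply: envelope_monotone => //; exact: ltW.
      by rewrite ltr_pM2r// invr_gt0 ltr_pwDl.
  - move=> a t1 t2 a0 t10 t12; apply: lerD; first exact: envelope_monotone.
    by rewrite ler_wpM2l// lef_pV2 ?posrE ?lerD2l// ltr_pwDl// (le_trans t10).
  - move=> a a0; apply/cvgrPdist_le => e e0.
    have e20 : 0 < e / 2 by rewrite divr_gt0.
    have [tau tauP] := A_tends (2 * a) (e / 2) e20.
    near=> t.
    have t0 : 0 <= t by near: t; apply: nbhs_pinfty_ge; rewrite num_real.
    have ttau : tau + 1 <= t by near: t; apply: nbhs_pinfty_ge; rewrite num_real.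
    have ta : a / (e / 2) <= t by near: t; apply: nbhs_pinfty_ge; rewrite num_real.
    have t10 : 0 < 1 + t by rewrite ltr_pwDl.
    rewrite sub0r normrN ger0_norm; last by rewrite addr_ge0 ?envelope_ge0// divr_ge0// ltW.
    have h1 : envelope A a t <= e / 2.
      apply: envelope_le => //; first exact: ltW.
      by move=> a' b v Aabv aa tb; apply: tauP Aabv aa _; lra.
    have h2 : a / (1 + t) <= e / 2.
      rewrite ler_pdivrMr// mulrC -ler_pdivrMr//; lra.
    by rewrite /beta; lra.
move=> a b v Aabv; have [a0 v0] := A0 _ _ _ Aabv.
(* At [a = 0] the smallness hypothesis forces [v <= 0]; for [a > 0] the kernel equals [1] at
   [r = a], [t = b]. *)
move: a0; rewrite le_eqVlt => /orP[/eqP a0|a0].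
  rewrite -a0 /beta /envelope ltxx mul0r addr0.
  apply/ler_addgt0Pr => e e0; rewrite add0r.
  by have [r r0 rP] := A_small e e0; apply: rP Aabv _; rewrite -a0 ltW.
have b0 := A_time _ _ _ Aabv.
apply: (@le_trans _ _ (envelope A a b)); last first.
  by rewrite lerDl divr_ge0 ?ltW// ltr_pwDl.
have := envelope_mem b lbA a0 Aabv; rewrite divff ?gt_eqF// (_ : 2 - 1 = 1); last by ring.
by rewrite addrK clip1 !mulr1.
Unshelve. all: by end_near. Qed.

(** * The closed loop *)

Lemma derivative_on_is_derive (R : realType) n (T : \bar R) (x dx : R -> 'rV[R]_n)
    (t : R) i :
  derivative_on (time_itv T) x dx -> 0 < t -> (t%:E < T)%E ->
  is_derive t (1 : R) (fun s => x s 0 i) (dx t 0 i).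
Proof.
move=> /derivative_onP xdx t0 tT; have Dt : time_itv T t by split=> //; exact: ltW.
suff lim : (fun h : R => h^-1 *: (x (h *: (1 : R) + t) 0 i - x t 0 i)) @ 0^' -->
    dx t 0 i.
  by apply: DeriveDef; [apply/cvg_ex; exists (dx t 0 i)|exact: cvg_lim].
have [u tu uT] : exists2 u : R, t < u & (u%:E <= T)%E.
  case: T {xdx Dt} tT => [T|_|//]; first by rewrite lte_fin; exists T.
  by exists (t + 1); [rewrite ltrDl|rewrite leey].
apply/cvgrPdist_le => e e0; have [h h0 hP] := xdx t Dt e e0.
rewrite near_withinE; apply/nbhs_ballP.
pose k := Num.min h (Num.min t (u - t)).
have k0 : 0 < k by rewrite !lt_min h0 t0 subr_gt0.
exists k => // q; rewrite -ball_normE /= sub0r normrN !lt_min => /and3P[qh qt qu] q0.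
have Dq : time_itv T (q + t).
  move: qt qu; rewrite !ltr_norml => /andP[? ?] /andP[? ?]; split; first lra.
  by rewrite (lt_le_trans _ uT)// lte_fin; lra.
have := hP _ Dq; rewrite addrK => /(_ (ltW qh)) H.
rewrite -(ler_pM2r (_ : 0 < `|q|)) ?normr_gt0//; apply: le_trans H.
rewrite (_ : q *: (1 : R) = q); last exact: mulr1.
have := rv_coord_le (x (q + t) - x t - q *: dx t) i; apply: le_trans.
rewrite !mxE -normrM distrC mulrBl (_ : _ *: _ * q = x (q + t) 0 i - x t 0 i).
  by rewrite [dx t 0 i * q]mulrC.
by rewrite /GRing.scale /= mulrAC mulVf// mul1r.
Qed.

(** The mean value theorem is applied to each coordinate. It takes derivatives in the open interval
    only, so time [0], where the derivative is one-sided, enters just through continuity. *)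
Lemma derivative_on_trajectory (R : realType) n (T : \bar R) (x dx : R -> 'rV[R]_n)
    (t : R) :
  derivative_on (time_itv T) x dx -> {within time_itv T, continuous dx} ->
  (t%:E < T)%E -> trajectory t x dx.
Proof.
move=> xdx dxc tT; split; last first.
  have sub : `[0, t] `<=` time_itv T.
    move=> s /=; rewrite in_itv /= => /andP[s0 st]; split=> //.
    by rewrite (le_lt_trans _ tT)// lee_fin.
  have /compact_bounded[C [_ CP]] : compact (dx @` `[0, t]).
    apply: continuous_compact; last exact: segment_compact.
    exact: continuous_subspaceW sub dxc.
  exists (C + 1) => s st; apply: (CP (C + 1)); first by rewrite ltrDl.
  by exists s => //=; rewrite in_itv.
move=> i a b v K a0; rewrite le_eqVlt => /orP[/eqP <- _ _|ab bt dxK].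
  by rewrite !subrr mul0r subr0 normr0 mulr0.
have inT s : a <= s <= b -> time_itv T s.
  move=> /andP[s1 s2]; split; first exact: le_trans s1.
  by rewrite (le_lt_trans _ tT)// lee_fin (le_trans s2).
have der s : s \in `]a, b[ -> is_derive s (1 : R) (fun q => x q 0 i) (dx s 0 i).
  rewrite in_itv /= => /andP[s1 s2].
  have [_ sT] : time_itv T s by apply: inT; rewrite !ltW.
  by apply: (derivative_on_is_derive i xdx) => //; exact: le_lt_trans s1.
have cont : {within `[a, b], continuous (fun q => x q 0 i)}.
  apply/subspace_continuousP => s /=; rewrite in_itv /= => sab.
  apply/cvgrPdist_le => e e0; rewrite near_withinE.
  move/derivative_onP : xdx => /(_ s (inT _ sab) 1 ltr01)[h h0 hP].
  pose D := 1 + `|dx s|; have D0 : 0 < D by rewrite ltr_pwDl.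
  pose k := Num.min h (e / D).
  have k0 : 0 < k by rewrite lt_min h0 divr_gt0.
  apply/nbhs_ballP; exists k => // q; rewrite -ball_normE /= lt_min => /andP[qh qe].
  rewrite in_itv /= => qab; rewrite distrC in qh; rewrite distrC in qe.
  have := hP q (inT _ qab) (ltW qh); rewrite mul1r => H.
  have h1 : `|(x q - x s) 0 i| <= `|x q - x s| by exact: rv_coord_le.
  rewrite !mxE in h1; rewrite distrC; apply: le_trans h1 _.
  have := ler_normD (x q - x s - (q - s) *: dx s) ((q - s) *: dx s).
  rewrite subrK normrZ => h2; apply: (le_trans h2).
  apply: (@le_trans _ _ (`|q - s| * D)); first by rewrite /D mulrDr mulr1 lerD2r.
  by rewrite -ler_pdivlMr// ltW.
have [c] := MVT ab der cont; rewrite in_itv /= => /andP[ac cb] ->.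
rewrite [_ * (b - a)]mulrC -mulrBr normrM ger0_norm ?subr_ge0 ?(ltW ab)// [leLHS]mulrC.
by rewrite ler_wpM2r ?subr_ge0 ?(ltW ab)// dxK// !ltW.
Qed.

(** The first bound is adapted to small [a] and the second to large [a]; they serve at scales below
    and above 1. *)
Lemma hfun_le (R : realType) (a b : R) : 0 <= a -> 0 <= b ->
  hfun a b <= a * (1 + b) /\ hfun a b <= 1 + b.
Proof.
move=> a0 b0; have a1 : 0 < 1 + a by rewrite ltr_pwDl.
have b1 : 0 <= 1 + b by rewrite addr_ge0.
split; rewrite /hfun.
  by rewrite ler_wpM2r// ler_pdivrMr// mulrDr mulr1 lerDl mulr_ge0.
by rewrite ler_piMl// ler_pdivrMr// mul1r lerDr.
Qed.

Lemma hnorm_ge0 (R : realType) N (r x : 'rV[R]_N) : 0 <= hnorm r x.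
Proof. by apply: sumr_ge0 => i _; exact: powR_ge0. Qed.

Lemma hnorm_le (R : realType) N (r x : 'rV[R]_N) (L l : R) :
  is_weight r -> 0 <= L -> 0 <= l -> (forall i, `|x 0 i| <= L * l `^ r 0 i) ->
  hnorm r x <= (\sum_i L `^ (r 0 i)^-1) * l.
Proof.
move=> r0 L0 l0 xL; rewrite mulr_suml; apply: ler_sum => i _.
apply: (@le_trans _ _ ((L * l `^ r 0 i) `^ (r 0 i)^-1)).
  by apply: ler_powR_base => //; rewrite invr_ge0 ltW.
by rewrite powRM ?powR_ge0// powR_rootK.
Qed.

(** [hfun] glues its arguments as [biscale] glues the weights: at scales below 1 its second argument
    is bounded and it behaves like the first, while above 1 the quotient [a / (1 + a)] is at most 1
    and it grows like the second. *)
Lemma hfun_biscale (R : realType) n m (r0 ry : 'rV[R]_n) (s0 sy : 'rV[R]_m) (L : R) :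
  is_weight r0 -> is_weight ry -> is_weight s0 -> is_weight sy -> 0 <= L ->
  exists2 C, 0 < C & forall (l : R) (x : 'rV[R]_n), 0 < l ->
    (forall i, `|x 0 i| <= L * biscale r0 ry l i) ->
    forall i, hfun (hnorm r0 x `^ s0 0 i) (hnorm ry x `^ sy 0 i) <=
      C * biscale s0 sy l i.
Proof.
move=> r00 ry0 s00 sy0 L0.
pose C0 := \sum_i L `^ (r0 0 i)^-1; pose Cy := \sum_i L `^ (ry 0 i)^-1.
have C00 : 0 <= C0 by apply: sumr_ge0 => i _; exact: powR_ge0.
have Cy0 : 0 <= Cy by apply: sumr_ge0 => i _; exact: powR_ge0.
pose C i := (1 + C0 `^ s0 0 i) * (1 + Cy `^ sy 0 i).
exists (\big[Num.max/1]_i C i).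
  by apply: (lt_le_trans ltr01); exact: bigmax_ge_id.
move=> l x l0 xL i.
apply: (@le_trans _ _ (C i * biscale s0 sy l i)); last first.
  by rewrite ler_wpM2r ?(ltW (biscale_gt0 _ _ _ l0))//; exact: le_bigmax_cond.
have p0 := powR_ge0 C0 (s0 0 i); have py := powR_ge0 Cy (sy 0 i).
have a0 := powR_ge0 (hnorm r0 x) (s0 0 i).
have b0 := powR_ge0 (hnorm ry x) (sy 0 i).
have [h1 h2] := hfun_le a0 b0.
have s0i := ltW (s00 i); have syi := ltW (sy0 i).
move: xL; rewrite /biscale; have [l1|l1] := leP l 1 => xL.
  have ale : hnorm r0 x `^ s0 0 i <= C0 `^ s0 0 i * l `^ s0 0 i.
    rewrite -(powRM _ C00 (ltW l0)) ler_powR_base// ?hnorm_ge0//.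
    by apply: hnorm_le => //; exact: ltW.
  (* Below scale 1 the state is also within [L] times scale 1, and there [hnorm_le] applies with the
     weights [ry]. *)
  have ble : hnorm ry x `^ sy 0 i <= Cy `^ sy 0 i.
    rewrite ler_powR_base// ?hnorm_ge0// -[Cy]mulr1.
    apply: hnorm_le => // j; apply: le_trans (xL j) _.
    rewrite one_powR; apply: ler_wpM2l => //; rewrite -(one_powR (r0 0 j)).
    by apply: ler_powR_base => //; exact: ltW.
  have ale' : hnorm r0 x `^ s0 0 i <= (1 + C0 `^ s0 0 i) * l `^ s0 0 i.
    by rewrite mulrDl mul1r (le_trans ale)// lerDr powR_ge0.
  have ble' : 1 + hnorm ry x `^ sy 0 i <= 1 + Cy `^ sy 0 i.
    rewrite lerD2l.
    exact: ble.
  have b10 : 0 <= 1 + hnorm ry x `^ sy 0 i := addr_ge0 ler01 b0.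
  apply: le_trans h1 _; apply: le_trans (ler_pM a0 b10 ale' ble') _.
  by rewrite /C mulrAC lexx.
have ble : hnorm ry x `^ sy 0 i <= Cy `^ sy 0 i * l `^ sy 0 i.
  rewrite -(powRM _ Cy0 (ltW l0)) ler_powR_base// ?hnorm_ge0//.
  by apply: hnorm_le => //; exact: ltW.
have ly : 1 <= l `^ sy 0 i by rewrite -(one_powR (sy 0 i)); apply: ler_powR_base => //; exact: ltW.
apply: le_trans h2 _.
apply: (@le_trans _ _ ((1 + Cy `^ sy 0 i) * l `^ sy 0 i)).
  by rewrite mulrDl mul1r lerD.
have H : 0 <= (1 + Cy `^ sy 0 i) * l `^ sy 0 i.
  exact: mulr_ge0 (addr_ge0 ler01 py) (powR_ge0 _ _).
have H1 : 1 <= 1 + C0 `^ s0 0 i.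
  rewrite lerDl.
  exact: p0.
apply: le_trans (ler_peMl H H1) _.
rewrite mulrA.
exact: lexx.
Qed.

Lemma class_K_le (R : realType) (g : R -> R) (a b : R) :
  class_K g -> 0 <= a -> a <= b -> g a <= g b.
Proof.
move=> [_ _ gi] a0; rewrite le_eqVlt => /orP[/eqP -> //|ab].
by rewrite ltW// gi.
Qed.

Lemma class_K_small (R : realType) (g : R -> R) (e : R) :
  class_K g -> 0 < e -> exists2 h, 0 < h & forall a, 0 <= a -> a <= h -> g a <= e.
Proof.
move=> [gc g0 _] e0; move/subspace_continuousP : gc => /(_ 0 (lexx _)).
move=> /cvgrPdist_le /(_ _ e0); rewrite near_withinE => /nbhs_ballP[h /= h0 hP].
exists (h / 2); first by rewrite divr_gt0.
move=> a a0 ah; have := hP a; rewrite -ball_normE /= sub0r normrN ger0_norm//.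
rewrite /from_subspace g0 sub0r normrN => H.
by apply: le_trans (ler_norm _) (H _ a0); lra.
Qed.

Lemma class_KL_tends (R : realType) (b : R -> R -> R) (a e : R) :
  class_KL b -> 0 <= a -> 0 < e ->
  exists2 tau, 0 <= tau & forall t, tau <= t -> b a t <= e.
Proof.
move=> [_ _ _ bt] a0 e0; have /cvgrPdist_le /(_ _ e0) [M [_ MP]] := bt a a0.
exists (Num.max 0 (M + 1)); first by rewrite le_max lexx.
move=> t; rewrite ge_max => /andP[t0 Mt]; have := MP t; rewrite /= sub0r normrN => H.
by apply: le_trans (ler_norm _) (H _); lra.
Qed.

Definition closed_loop (R : realType) (n m p : nat)
    (f : 'rV[R]_n * 'rV[R]_m -> 'rV[R]_n) (r0 ry : 'rV[R]_n) (s0 sy : 'rV[R]_m)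
    (cG : R) (gamma_z : R -> R) (beta_d : R -> R -> R) (T : \bar R)
    (x dx : R -> 'rV[R]_n) (delta : R -> 'rV[R]_m) (z : R -> 'rV[R]_p) : Prop :=
  [/\ derivative_on (time_itv T) x dx, {within time_itv T, continuous dx},
      forall t, time_itv T t -> dx t = f (x t, delta t),
      forall s t : R, 0 <= s -> s <= t -> (t%:E < T)%E ->
        enorm (z t) <= Num.max (beta_d (enorm (z s)) (t - s))
          (sup [set gamma_z (enorm (x k)) | k in `[s, t]]) &
      forall (s t : R) (i : 'I_m), 0 <= s -> s <= t -> (t%:E < T)%E ->
        `|delta t 0 i| <= Num.max (beta_d (enorm (z s)) (t - s))
          (cG * sup [set hfun (hnorm r0 (x k) `^ s0 0 i) (hnorm ry (x k) `^ sy 0 i)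
                    | k in `[s, t]])].

Lemma sup_itv_le (R : realType) (g : R -> R) (s t e : R) : s <= t ->
  (forall k, s <= k <= t -> g k <= e) -> sup [set g k | k in `[s, t]] <= e.
Proof.
move=> st ge; apply: ge_sup; first by exists (g s), s => //=; rewrite in_itv /= lexx.
by move=> _ [k /= + <-]; rewrite in_itv /=; exact: ge.
Qed.

(** The gain is [c / C]: while [x] stays within [2 * L] times the scale, [hfun] is at most [C] times
    the input scale, so [delta] is admissible for [scale_contraction], which returns the better
    factor [L]. The gap between [L] and [2 * L] closes the exit argument. For the contraction, the
    part of [delta] due to [z] is first left to decay. *)
Lemma small_gain (R : realType) (n m p : nat)
  (f f0 fy : 'rV[R]_n * 'rV[R]_m -> 'rV[R]_n)
  (r0 ry : 'rV[R]_n) (s0 sy : 'rV[R]_m) (d0 dy : R) :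
  is_weight r0 -> is_weight ry -> is_weight s0 -> is_weight sy ->
  continuous f -> vf_homogeneous_bilimit f r0 s0 d0 f0 ry sy dy fy ->
  globally_asymptotically_stable (fun x => f (x, 0)) ->
  globally_asymptotically_stable (fun x => f0 (x, 0)) ->
  globally_asymptotically_stable (fun x => fy (x, 0)) ->
  exists cG c L, [/\ 0 < cG, 0 < c, 1 <= L,
    forall gamma_z beta_d T x dx delta (z : R -> 'rV[R]_p) l s,
      class_KL beta_d ->
      closed_loop f r0 ry s0 sy cG gamma_z beta_d T x dx delta z ->
      0 < l -> 0 <= s ->
      (forall i, `|x s 0 i| <= biscale r0 ry l i) ->
      (forall i, beta_d (enorm (z s)) 0 <= c * biscale s0 sy l i) ->
      forall t, s <= t -> (t%:E < T)%E ->
      forall i, `|x t 0 i| <= L * biscale r0 ry l i &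
    forall beta_d l Z, class_KL beta_d -> 0 < l -> 0 <= Z ->
      exists2 tau, 0 <= tau &
      forall gamma_z T x dx delta (z : R -> 'rV[R]_p) s,
        closed_loop f r0 ry s0 sy cG gamma_z beta_d T x dx delta z -> 0 <= s ->
        (forall k, s <= k -> (k%:E < T)%E -> forall i, `|x k 0 i| <= biscale r0 ry l i) ->
        enorm (z s) <= Z ->
        forall t, s + tau <= t -> (t%:E < T)%E ->
        forall i, `|x t 0 i| <= biscale r0 ry (l / 2) i].
Proof.
move=> r00 ry0 s00 sy0 fc hom fgas f0gas fygas.
have [c [L [c0 L1 contr]]] := scale_contraction r00 ry0 s00 sy0 fc hom fgas f0gas fygas.
have L20 : 0 <= 2 * L by lra.
have [C C0 CP] := hfun_biscale r00 ry0 s00 sy0 L20.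
have input gamma_z beta_d T x dx delta (z : R -> 'rV[R]_p) l s t :
    closed_loop f r0 ry s0 sy (c / C) gamma_z beta_d T x dx delta z ->
    0 < l -> 0 <= s -> s <= t -> (t%:E < T)%E ->
    (forall k, s <= k <= t -> forall i, `|x k 0 i| <= 2 * L * biscale r0 ry l i) ->
    (forall i, beta_d (enorm (z s)) (t - s) <= c * biscale s0 sy l i) ->
    forall i, `|delta t 0 i| <= c * biscale s0 sy l i.
  move=> [_ _ _ _ dP] l0 s0' st tT xk bd i.
  apply: le_trans (dP s t i s0' st tT) _; rewrite ge_max bd /=.
  apply: (@le_trans _ _ (c / C * (C * biscale s0 sy l i))).
    rewrite ler_wpM2l ?divr_ge0 ?(ltW c0) ?(ltW C0)//.
    by apply: sup_itv_le => // k /xk xkl; exact: CP.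
  by rewrite mulrA divfK ?gt_eqF.
have shift gamma_z beta_d T x dx delta (z : R -> 'rV[R]_p) s t :
    closed_loop f r0 ry s0 sy (c / C) gamma_z beta_d T x dx delta z ->
    0 <= s -> s <= t -> (t%:E < T)%E ->
    trajectory (t - s) (fun r => x (s + r)) (fun r => dx (s + r)) /\
    forall q, 0 <= q <= t - s -> dx (s + q) = f (x (s + q), delta (s + q)).
  move=> [xdx dxc dxf _ _] s0' st tT; split.
    by apply: trajectory_shift => //; exact: derivative_on_trajectory tT.
  move=> q /andP[q0 qt]; apply: dxf; split; first exact: addr_ge0.
  by rewrite (le_lt_trans _ tT)// lee_fin; lra.
exists (c / C), c, L; split=> //; first by rewrite divr_gt0.
- move=> gamma_z beta_d T x dx delta z l s KL cl l0 s0' xs bd t st tT.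
  have [_ KLK KLd _] := KL.
  have [tx dxf] := shift _ _ _ _ _ _ _ _ _ cl s0' st tT.
  have wp i := biscale_gt0 r0 ry i l0.
  have [tau _ ctr] := contr l l0.
  have claim r : 0 <= r <= t - s ->
      (forall q, 0 <= q <= r -> forall i, `|x (s + q) 0 i| <= 2 * L * biscale r0 ry l i) ->
      forall i, `|x (s + r) 0 i| <= L * biscale r0 ry l i.
    move=> /andP[r0' rt] xq i.
    have [|||H _] := ctr r _ _ (fun q => delta (s + q)) r0' (trajectory_sub rt tx) _ _ _ i.
    + by move=> q /andP[q0 qr]; apply: dxf; rewrite q0 (le_trans qr).
    + by move=> j; rewrite addr0.
    2: exact: H.
    move=> q /andP[q0 qr]; apply: (input _ _ _ _ _ _ _ l s (s + q) cl) => //.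
    + by rewrite lerDl.
    + by rewrite (le_lt_trans _ tT)// lee_fin; lra.
    + move=> k /andP[sk kq]; have := xq (k - s); rewrite subrKC; apply.
      by apply/andP; split; lra.
    + move=> j; apply: le_trans (bd j); apply: KLd => //; first exact: sqrtr_ge0.
      by rewrite addrAC subrr add0r.
  (* Dividing each coordinate by its scale turns the exit condition into one on a single scalar, the
     sup norm of [y]. *)
  pose y q := \row_i (x (s + 1 * q) 0 i / biscale r0 ry l i).
  have ty := trajectory_rescale ltr01 wp tx; rewrite divr1 in ty.
  have [K yK] := trajectory_norm_lipschitz ty.
  have yE q b : (forall i, `|x (s + q) 0 i| <= b * biscale r0 ry l i) ->
      0 <= b -> `|y q| <= b.
    move=> H b0; apply: rv_norm_le => // i.
    rewrite mxE normrM [`|_^-1|]gtr0_norm ?invr_gt0// ler_pdivrMr// mul1r; exact: H.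
  have yE' q b : `|y q| <= b -> forall i, `|x (s + q) 0 i| <= b * biscale r0 ry l i.
    move=> yb i; have := le_trans (rv_coord_le (y q) i) yb.
    by rewrite mxE normrM [`|_^-1|]gtr0_norm ?invr_gt0// ler_pdivrMr// mul1r.
  have [yL|] := pselect (forall q, 0 <= q <= t - s -> `|y q| <= 2 * L).
    have := claim (t - s); rewrite subrKC; apply; first by rewrite lexx subr_ge0 st.
    by move=> q qt; apply: yE'; exact: yL.
  move=> /existsNP[q /not_implyP[/andP[q0 qt] /negP]]; rewrite -ltNge => yq.
  have y0L : `|y 0| <= 2 * L.
    apply: yE => // i; rewrite addr0 (le_trans (xs i))// ler_peMl ?(ltW (wp i))//; lra.
  have yKq a b : 0 <= a -> a <= b -> b <= q -> `| `|y b| - `|y a| | <= K * (b - a).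
    by move=> a0 ab bq; apply: yK => //; exact: le_trans qt.
  have [r [r0' rq yr yle]] := first_hit yKq q0 y0L (ltW yq).
  (* At the exit time this norm is [2 * L], which exceeds [L] because [1 <= L]. *)
  have : `|y r| <= L.
    apply: yE; last lra.
    apply: claim; first by rewrite r0' (le_trans rq).
    by move=> q' q'r; apply: yE'; exact: yle.
  by rewrite yr; lra.
- move=> beta_d l Z KL l0 Z0; have [_ KLK KLd _] := KL.
  have [e e0 eP] : exists2 e : R, 0 < e & forall i, e <= c * biscale s0 sy l i.
    exists (\big[Num.min/1]_i (c * biscale s0 sy l i)).
      by apply/bigmin_gtP; split=> // i _; rewrite mulr_gt0// biscale_gt0.
    by move=> i; exact: bigmin_le_cond.
  (* After [tau1], [beta_d] of any size up to [Z] is an admissible input. *)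
  have [tau1 tau10 tau1P] := class_KL_tends KL Z0 e0.
  have [tau tau0 ctr] := contr l l0.
  exists (tau1 + tau); first by rewrite addr_ge0// ltW.
  move=> gamma_z T x dx delta z s cl s0' xk zs t st tT i.
  have s1 : 0 <= s + tau1 by rewrite addr_ge0.
  have s1t : s + tau1 <= t by lra.
  have [tx dxf] := shift _ _ _ _ _ _ _ _ _ cl s1 s1t tT.
  have [|||_ H] := ctr (t - (s + tau1)) _ _ (fun q => delta (s + tau1 + q)) _ tx dxf _ _ i.
  + by rewrite subr_ge0.
  + move=> j; rewrite addr0; apply: xk; first lra.
    by rewrite (le_lt_trans _ tT)// lee_fin.
  + move=> q /andP[q0 qt].
    have kT k : k <= s + tau1 + q -> (k%:E < T)%E.
      by move=> kq; rewrite (le_lt_trans _ tT)// lee_fin; lra.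
    apply: (input _ _ _ _ _ _ _ l s _ cl) => //; [lra|exact: kT| |].
      move=> k /andP[sk kq] j; apply: le_trans (xk k sk (kT k kq) j) _.
      by rewrite ler_peMl ?(ltW (biscale_gt0 _ _ _ l0))//; lra.
    move=> j; apply: le_trans (eP j).
    have q1 : tau1 <= s + tau1 + q - s by lra.
    have q2 : 0 <= s + tau1 + q - s by lra.
    apply: le_trans (tau1P _ q1).
    exact: (class_K_le (KLK _ q2) (sqrtr_ge0 _) zs).
  by move: H; rewrite subrKC; apply; lra.
Qed.

Lemma enorm_row_mx (R : realType) n m (x : 'rV[R]_n) (z : 'rV[R]_m) :
  enorm x <= enorm (row_mx x z) /\ enorm z <= enorm (row_mx x z).
Proof.
have E : \sum_(i < n + m) row_mx x z 0 i ^+ 2 =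
    \sum_(i < n) x 0 i ^+ 2 + \sum_(i < m) z 0 i ^+ 2.
  rewrite big_split_ord /=; congr (_ + _).
    by apply: eq_bigr => i _; rewrite row_mxEl.
  by apply: eq_bigr => i _; rewrite row_mxEr.
have x0 : 0 <= \sum_(i < n) x 0 i ^+ 2 by apply: sumr_ge0 => i _; exact: sqr_ge0.
have z0 : 0 <= \sum_(i < m) z 0 i ^+ 2 by apply: sumr_ge0 => i _; exact: sqr_ge0.
rewrite /enorm E; split; rewrite ler_sqrt ?addr_ge0//.
  by rewrite lerDl.
by rewrite lerDr.
Qed.

Lemma enorm_le (R : realType) n (x : 'rV[R]_n) (e : R) :
  0 <= e -> (forall i, n.+1%:R * `|x 0 i| <= e) -> enorm x <= e.
Proof.
move=> e0 xe; apply: le_trans (enorm_le_norm x) _.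
rewrite mulrC -ler_pdivlMr//; apply: rv_norm_le => [|i]; first by rewrite divr_ge0.
by rewrite ler_pdivlMr// mulrC.
Qed.

Theorem corollary2p22 (R : realType) (n m p : nat)
  (f f0 fy : 'rV[R]_n * 'rV[R]_m -> 'rV[R]_n)
  (r0 ry : 'rV[R]_n) (s0 sy : 'rV[R]_m) (d0 dy : R)
  (r0_gt0 : is_weight r0) (ry_gt0 : is_weight ry)
  (s0_gt0 : is_weight s0) (sy_gt0 : is_weight sy)
  (f_cont : continuous f)
  (f_hom : vf_homogeneous_bilimit f r0 s0 d0 f0 ry sy dy fy)
  (f_gas : globally_asymptotically_stable (fun x => f (x, 0)))
  (f0_gas : globally_asymptotically_stable (fun x => f0 (x, 0)))
  (fy_gas : globally_asymptotically_stable (fun x => fy (x, 0)))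
  (p_ge1 : (1 <= p)%N) :
  exists2 cG : R, 0 < cG &
    forall (gamma_z : R -> R) (beta_d : R -> R -> R),
      class_K gamma_z -> class_KL beta_d ->
      exists2 beta_x : R -> R -> R, class_KL beta_x &
        forall (T : \bar R) (x dx : R -> 'rV[R]_n)
          (delta : R -> 'rV[R]_m) (z : R -> 'rV[R]_p),
          derivative_on (time_itv T) x dx ->
          {within time_itv T, continuous dx} ->
          {within time_itv T, continuous delta} ->
          {within time_itv T, continuous z} ->
          (forall t, time_itv T t -> dx t = f (x t, delta t)) ->
          (forall s t : R, 0 <= s -> s <= t -> (t%:E < T)%E ->
             enorm (z t) <=
             Num.max (beta_d (enorm (z s)) (t - s))
               (sup [set gamma_z (enorm (x k)) | k in `[s, t]])) ->
          (forall (s t : R) (i : 'I_m), 0 <= s -> s <= t -> (t%:E < T)%E ->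
             `|delta t 0 i| <=
             Num.max (beta_d (enorm (z s)) (t - s))
               (cG * sup [set hfun (hnorm r0 (x k) `^ s0 0 i)
                                   (hnorm ry (x k) `^ sy 0 i)
                         | k in `[s, t]])) ->
          forall s t : R, 0 <= s -> s <= t -> (t%:E < T)%E ->
            enorm (x t) <= beta_x (enorm (row_mx (x s) (z s))) (t - s).
Proof.
have [cG [c [L [cG0 c0 L1 bounded contract]]]] :=
  @small_gain R n m p f f0 fy r0 ry s0 sy d0 dy r0_gt0 ry_gt0 s0_gt0 sy_gt0
    f_cont f_hom f_gas f0_gas fy_gas.
exists cG => // gamma_z beta_d K KL.
have [_ KLK KLd _] := KL.
pose loop T x dx delta (z : R -> 'rV[R]_p) :=
  closed_loop f r0 ry s0 sy cG gamma_z beta_d T x dx delta z.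
pose w := biscale r0 ry; pose v := biscale s0 sy.
have L0 : 0 <= L by lra.
(* The halving times of the scales [l], [l / 2] and so on are added up. The bound [Z] must hold at
   every restart, because each halving begins with a decay of [beta_d]. *)
have iterate N : forall l Z, 0 < l -> 0 <= Z -> exists2 tau, 0 <= tau &
    forall T x dx delta z s, loop T x dx delta z -> 0 <= s ->
    (forall k, s <= k -> (k%:E < T)%E -> forall i, `|x k 0 i| <= w l i) ->
    (forall k, s <= k -> (k%:E < T)%E -> enorm (z k) <= Z) ->
    forall t, s + tau <= t -> (t%:E < T)%E -> forall i, `|x t 0 i| <= w (l / 2 ^+ N) i.
  elim: N => [|N IH] l Z l0 Z0.
    exists 0 => // T x dx delta z s _ _ xl _ t st tT i.
    by rewrite expr0 divr1; apply: xl => //; rewrite addr0 in st.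
  have [tau1 tau10 H1] := IH l Z l0 Z0.
  have lN : 0 < l / 2 ^+ N by rewrite divr_gt0// exprn_gt0.
  have [tau2 tau20 H2] := contract _ _ _ KL lN Z0.
  exists (tau1 + tau2); first exact: addr_ge0.
  move=> T x dx delta z s cl s_ge0 xl zZ t st tT i.
  have st1 : s + tau1 <= t by lra.
  have s1T : ((s + tau1)%:E < T)%E by rewrite (le_lt_trans _ tT)// lee_fin.
  rewrite exprSr invfM mulrA; apply: (H2 _ _ _ _ _ _ (s + tau1) cl) => //.
  - exact: addr_ge0.
  - by move=> k sk kT j; apply: (H1 _ _ _ _ _ s cl).
  - by apply: zZ => //; rewrite lerDl.
  - by rewrite -addrA.
have start r l : 0 < l -> (forall i, r <= w l i) -> (forall i, beta_d r 0 <= c * v l i) ->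
    forall T x dx delta z s, loop T x dx delta z -> 0 <= s ->
    enorm (row_mx (x s) (z s)) <= r -> forall t, s <= t -> (t%:E < T)%E ->
    forall i, `|x t 0 i| <= L * w l i.
  move=> l0 rw rv T x dx delta z s cl s_ge0 xzr t st tT i.
  have [xr zr] := enorm_row_mx (x s) (z s).
  apply: (bounded _ _ _ _ _ _ _ _ s KL cl) => //.
    move=> j; apply: le_trans (rw j); apply: le_trans xzr; apply: le_trans xr.
    exact: le_trans (rv_coord_le _ _) (norm_le_enorm _).
  move=> j; apply: le_trans (rv j).
  exact: (class_K_le (KLK _ (lexx 0)) (sqrtr_ge0 _) (le_trans zr xzr)).
(* Both families of sizes tend to infinity with the scale, so every initial state and input fit
   below some scale. *)
have scale r : exists2 l, 0 < l &
    (forall i, r <= w l i) /\ (forall i, beta_d r 0 <= c * v l i).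
  have [l1 l10 l1P] := biscale_large r0 r ry_gt0.
  have [l2 l20 l2P] := biscale_large s0 (beta_d r 0 / c) sy_gt0.
  exists (Num.max l1 l2); first by rewrite lt_max l10.
  split=> i; first by apply: l1P; rewrite le_max lexx.
  by rewrite mulrC -ler_pdivrMr//; apply: l2P; rewrite le_max lexx orbT.
(* Size at [s], elapsed time and size at [t], gathered over all trajectories, so that one majorant
   serves them all. *)
pose A a b e := exists T x dx delta z s t,
  [/\ loop T x dx delta z, 0 <= s, s <= t, (t%:E < T)%E &
      [/\ a = enorm (row_mx (x s) (z s)), b = t - s & e = enorm (x t)]].
have n1 : 0 < n.+1%:R :> R by [].
have bound r : exists2 X, 0 <= X & forall T x dx delta z s, loop T x dx delta z ->
    0 <= s -> enorm (row_mx (x s) (z s)) <= r ->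
    forall t, s <= t -> (t%:E < T)%E -> enorm (x t) <= X.
  have [l l0 [rw rv]] := scale r.
  exists (\big[Num.max/0]_i (n.+1%:R * (L * w l i))); first exact: bigmax_ge_id.
  move=> T x dx delta z s cl s_ge0 xzr t st tT.
  apply: enorm_le => [|i]; first exact: bigmax_ge_id.
  apply: (@le_trans _ _ (n.+1%:R * (L * w l i))); last exact: le_bigmax_cond.
  by rewrite ler_pM2l//; exact: (start r l l0 rw rv _ _ _ _ _ s cl).
have [||||beta_x KLx betaP] := @class_KL_majorant R A.
- split.
    move=> a b e [T [x [dx [delta [z [s [t [_ _ _ _ [-> _ ->]]]]]]]]].
    by split; exact: sqrtr_ge0.
  move=> r; have [X _ XP] := bound r; exists X.
  move=> a b e [T [x [dx [delta [z [s [t [cl s_ge0 st tT [-> _ ->]]]]]]]]] ar.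
  exact: XP cl s_ge0 ar _ st tT.
- move=> a b e [T [x [dx [delta [z [s [t [_ _ st _ [_ -> _]]]]]]]]].
  by rewrite subr_ge0.
- move=> e e0.
  have eL : 0 < e / n.+1%:R / L by rewrite !divr_gt0// (lt_le_trans ltr01).
  (* The scale is chosen from the target [e], allowing for the overshoot [L], and the initial radius
     from the scale. *)
  have [l l0 lP] := biscale_small ry r0_gt0 eL.
  have [h1 h10 h1P] : exists2 h : R, 0 < h & forall i, h <= w l i.
    exists (\big[Num.min/1]_i w l i).
      by apply/bigmin_gtP; split=> // i _; exact: biscale_gt0.
    by move=> i; exact: bigmin_le_cond.
  have [h2 h20 h2P] : exists2 h : R, 0 < h & forall i, h <= c * v l i.
    exists (\big[Num.min/1]_i (c * v l i)).
      by apply/bigmin_gtP; split=> // i _; rewrite mulr_gt0// biscale_gt0.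
    by move=> i; exact: bigmin_le_cond.
  have [h3 h30 h3P] := class_K_small (KLK _ (lexx 0)) h20.
  pose r := Num.min h1 h3.
  have r_gt0 : 0 < r by rewrite lt_min h10.
  exists r => // a b x1 [T [x [dx [delta [z [s [t [cl s_ge0 st tT [-> _ ->]]]]]]]]] ar.
  apply: enorm_le => [|i]; first exact: ltW.
  rewrite mulrC -ler_pdivlMr//.
  apply: (@le_trans _ _ (L * w l i)).
    apply: (start r l l0 _ _ _ _ _ _ _ s cl) => // j.
      by apply: le_trans (h1P j); rewrite ge_min lexx.
    apply: le_trans (h2P j); apply: h3P; first exact: ltW.
    by rewrite ge_min lexx orbT.
  by rewrite mulrC -ler_pdivlMr ?lP// (lt_le_trans ltr01).
- move=> r e e0; have [r_lt0|r_ge0] := ltP r 0.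
    exists 0 => a b x1 [T [x [dx [delta [z [s [t [_ _ _ _ [-> _ _]]]]]]]]] ar _.
    by have := lt_le_trans r_lt0 (sqrtr_ge0 _ : 0 <= enorm (row_mx (x s) (z s))); rewrite ltNge ar.
  have [X X0 XP] := bound r; have [l l0 [rw rv]] := scale r.
  (* The scale [l1] absorbs the overshoot factor [L] of the starting scale [l], so the state never
     exceeds it and the halvings can start from it. *)
  have [l1 l10 l1P] := biscale_large r0 (\big[Num.max/0]_i (L * w l i)) ry_gt0.
  (* [z] stays below [Z] from time [s] on: [beta_d r 0] covers its value at [s], and [gamma_z X] the
     influence of [x], itself bounded by [X]. *)
  pose Z := Num.max (beta_d r 0) (gamma_z X).
  have [h h0 hP] := biscale_small ry r0_gt0 (divr_gt0 e0 n1).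
  have [N NP] : exists N : nat, l1 / 2 ^+ N <= h.
    exists (Num.truncn (l1 / h)).+1.
    rewrite ler_pdivrMr ?exprn_gt0// mulrC -ler_pdivrMr//.
    apply: (le_trans (ltW (truncnS_gt _))).
    by rewrite -natrX ler_nat ltnW// ltn_expl.
  have Z0 : 0 <= Z.
    rewrite le_max; apply/orP; left.
    have [_ bz _] := KLK _ (lexx (0 : R)).
    by move: (class_K_le (KLK _ (lexx 0)) (lexx 0) r_ge0) bz => /= h4 bz0; rewrite bz0 in h4.
  have [tau tau0 tauP] := iterate N l1 Z l10 Z0.
  exists tau => a b x1 [T [x [dx [delta [z [s [t [cl s_ge0 st tT [-> -> ->]]]]]]]]] ar taut.
  apply: enorm_le => [|i]; first exact: ltW.
  rewrite mulrC -ler_pdivlMr//; apply: le_trans (hP i).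
  apply: (@le_trans _ _ (w (l1 / 2 ^+ N) i)); last first.
    by apply: biscale_le => //; rewrite divr_gt0// exprn_gt0.
  apply: (tauP _ _ _ _ _ s cl) => //; last lra.
    move=> k sk kT j; apply: le_trans (start r l l0 rw rv _ _ _ _ _ s cl s_ge0 ar k sk kT j) _.
    by apply: le_trans (l1P l1 (lexx _) j); exact: le_bigmax_cond.
  move=> k sk kT; have [_ _ _ zP _] := cl.
  apply: le_trans (zP s k s_ge0 sk kT) _; rewrite /Z ge_max !le_max.
  apply/andP; split; apply/orP; [left|right].
    apply: (@le_trans _ _ (beta_d (enorm (z s)) 0)).
      by apply: KLd => //; [exact: sqrtr_ge0|rewrite subr_ge0].
    have [_ zr] := enorm_row_mx (x s) (z s).
    exact: (class_K_le (KLK _ (lexx 0)) (sqrtr_ge0 _) (le_trans zr ar)).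
  apply: sup_itv_le => // q /andP[sq qk]; apply: class_K_le => //; first exact: sqrtr_ge0.
  apply: (XP _ _ _ _ _ s cl) => //.
  by rewrite (le_lt_trans _ kT)// lee_fin.
exists beta_x => // T x dx delta z xdx dxc _ _ dxf zP dP s t s_ge0 st tT.
by apply: betaP; exists T, x, dx, delta, z, s, t; split.
Qed.
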